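(* Let $p$ be a prime and let $G$ be a $p$-group of order $p^n$, $n\ge1$, with $p$-degrees $(r_1,\dots,r_\ell)$. Define $$\delta_G=\frac{\bigl(\sum_{j=1}^{\ell} j r_j\bigr)^2}{\sum_{j=1}^{\ell} j^2 r_j}.$$ Then, over the field $\mathbb{F}_p$, the multiplication tensor $M_G$ of $G$ satisfies $$\operatorname{slice-rank}(M_G)\le 3\,|G|\,e^{-\delta_G/18}.$$ In particular, there are absolute constants $C,c>0$ (independent of $p$, $n$ and $G$) such that $\operatorname{slice-rank}(M_G)\le C\,p^n/e^{c\,\delta_G}$.
   Context: Slice rank. For finite sets $X,Y,Z$ and a field $\mathbb{F}$, the slice rank of $F\colon X\times Y\times Z\to\mathbb{F}$ is the smallest $r$ such that, for some $0\le a\le b\le r$ and some functions $f_i,g_i$ with values in $\mathbb{F}$, $F(x,y,z)=\sum_{i=1}^a f_i(x,y)g_i(z)+\sum_{i=a+1}^b f_i(x,z)g_i(y)+\sum_{i=b+1}^r f_i(y,z)g_i(x)$. The multiplication tensor $M_G\colon G\times G\times G\to\mathbb{F}$ of a finite group $G$ is given by $M_G(x,y,z)=1$ if $xy=z$ and $0$ otherwise. $p$-degrees. For a finite $p$-group $G$ the $p$-lower central series is defined by $\Gamma_1=G$ and $\Gamma_i=[G,\Gamma_{i-1}]\,\Gamma_{\lceil i/p\rceil}^{(p)}$ for $i\ge2$, where for a subgroup $H$, $H^{(p)}$ is the subgroup generated by $\{h^p:h\in H\}$. The quotients $\Gamma_j/\Gamma_{j+1}$ are $\mathbb{F}_p$-vector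 spaces. The length $\ell$ is the minimal $\ell$ with $\Gamma_{\ell+1}=1$. The $p$-degrees of $G$ are $(r_1,\dots,r_\ell)$ with $r_j=\dim_{\mathbb{F}_p}\Gamma_j/\Gamma_{j+1}$. *)

(* Defs.v *)
From HB Require Import structures.
From mathcomp Require Import all_boot all_order all_fingroup all_algebra.
From mathcomp Require Import all_solvable mxabelem.
From mathcomp Require Import boolp reals.

Set Implicit Arguments.
Unset Strict Implicit.
Unset Printing Implicit Defensive.

Import Order.TTheory GRing.Theory Num.Theory.

Section SliceRank.
Local Open Scope ring_scope.
Variables (X Y Z : finType) (F : fieldType).

(* The families f_i, g_i are indexed by nat; only the indices below r matter. *)
Definition slice_decomp (T : X -> Y -> Z -> F) (r : nat) : Prop :=
  exists a b : nat, (a <= b <= r)%N /\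
  exists (f1 : nat -> X -> Y -> F) (g1 : nat -> Z -> F)
         (f2 : nat -> X -> Z -> F) (g2 : nat -> Y -> F)
         (f3 : nat -> Y -> Z -> F) (g3 : nat -> X -> F),
  forall x y z,
    T x y z = \sum_(0 <= i < a) f1 i x y * g1 i z
            + \sum_(a <= i < b) f2 i x z * g2 i y
            + \sum_(b <= i < r) f3 i y z * g3 i x.

Lemma slice_decomp_card T : slice_decomp T #|Z|.
Proof.
exists #|Z|, #|Z|; split; first by rewrite leqnn.
exists (fun i x y => \sum_(w | (enum_rank w == i :> nat)%N) T x y w).
exists (fun i z => (enum_rank z == i :> nat)%N%:R).
exists (fun _ _ _ => 0), (fun _ _ => 0), (fun _ _ _ => 0), (fun _ _ => 0).
move=> x y z; rewrite [X in _ + X + _]big_geq // [X in _ + _ + X]big_geq //.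
rewrite !addr0 big_mkord (bigD1 (enum_rank z)) //= eqxx mulr1.
rewrite [X in _ + X]big1 ?addr0; last first.
  by move=> i /negPf ne; rewrite -val_eqE /= in ne; rewrite eq_sym ne mulr0.
by rewrite (big_pred1 z) // => w; rewrite val_eqE (inj_eq enum_rank_inj).
Qed.

Lemma slice_decomp_ex T : exists r, `[< slice_decomp T r >].
Proof. by exists #|Z|; apply/asboolP/slice_decomp_card. Qed.

Definition slice_rank (T : X -> Y -> Z -> F) : nat :=
  ex_minn (slice_decomp_ex T).

End SliceRank.

Definition mul_tensor (F : fieldType) (G : finGroupType) (x y z : G) : F :=
  ((x * y)%g == z)%:R%R.
Arguments mul_tensor F G : clear implicits.

Section PLowerCentralSeries.
Variables (gT : finGroupType) (p : nat).
Implicit Types (A : {set gT}) (G : {group gT}).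

Definition ceil_divn (m d : nat) : nat := m %/ d + ~~ (d %| m).

Definition pow_subgroup A : {set gT} := <<[set (h ^+ p)%g | h in A]>>%g.
Canonical pow_subgroup_group A := [group of pow_subgroup A].

(* The recursion for Gamma_i calls both Gamma_(i-1) and Gamma_(ceil (i/p)), so *)
(* we tabulate: plcs_table A n = [:: A; Gamma_1; ...; Gamma_(n.+1)], where the *)
(* entry of index 0 is a dummy; plcsE below is the recursion itself.           *)
Fixpoint plcs_table A (n : nat) : seq {set gT} :=
  if n is n'.+1 then
    let s := plcs_table A n' in
    rcons s
      ([~: A, nth A s n'.+1] * pow_subgroup (nth A s (ceil_divn n'.+2 p)))%g
  else [:: A; A].

Definition plcs A (i : nat) : {set gT} := nth A (plcs_table A i) i.

Lemma ceil_divn_leq m d k : 0 < d -> (ceil_divn m d <= k) = (m <= k * d).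
Proof.
move=> d_gt0; rewrite /ceil_divn; case: (boolP (d %| m)) => [dvd | ndvd] /=.
  by rewrite addn0 leq_divLR.
rewrite addn1 ltn_divLR // ltn_neqAle; case: eqP => // eq_m.
by rewrite eq_m dvdn_mull in ndvd.
Qed.

Lemma ceil_divn_lt i : 1 < p -> 1 < i -> ceil_divn i p < i.
Proof.
move=> p_gt1; case: i => [|[|i]] // _.
rewrite ltnS ceil_divn_leq ?(ltnW p_gt1) //.
apply: (@leq_trans (i.+1 * 2)); last by rewrite leq_mul2l p_gt1 orbT.
by rewrite muln2 -addnn addnS ltnS leq_addr.
Qed.

Lemma size_plcs_table A n : size (plcs_table A n) = n.+2.
Proof. by elim: n => //= n IH; rewrite size_rcons IH. Qed.

Lemma nth_plcs_table A n i : i < n.+2 -> nth A (plcs_table A n) i = plcs A i.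
Proof.
have up m k j : j < m.+2 ->
    nth A (plcs_table A (m + k)) j = nth A (plcs_table A m) j.
  elim: k => [|k IH] lt_jm; first by rewrite addn0.
  rewrite addnS /= nth_rcons size_plcs_table.
  by rewrite (leq_trans lt_jm) ?IH // !ltnS leq_addr.
rewrite /plcs => lt_in; case/orP: (leq_total i n) => [le_in | le_ni].
  by rewrite -(subnKC le_in) up.
by rewrite -(up n (i - n)) ?subnKC.
Qed.

Lemma plcs1 A : plcs A 1 = A. Proof. by []. Qed.

Lemma plcsE A i : 1 < p -> 1 < i ->
  plcs A i
  = ([~: A, plcs A i.-1] * pow_subgroup (plcs A (ceil_divn i p)))%g.
Proof.
move=> p_gt1; case: i => [|[|i]] // _.
rewrite -(@nth_plcs_table A i.+1) //= nth_rcons size_plcs_table ltnn eqxx.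
by rewrite !nth_plcs_table ?ceil_divn_lt.
Qed.

(* The dimension over F_p, as the quotient is elementary abelian: see          *)
(* plcs_abelem and plcs_quotient_isog below.                                   *)
Definition p_degree A (j : nat) : nat := logn p #|plcs A j / plcs A j.+1|%g.

(* The default value 0 is not used for p-groups: see plcs_lengthP below.      *)
Definition plcs_length A : nat :=
  if pselect (exists l, plcs A l.+1 == 1%g) is left ex then ex_minn ex else 0.

Section Theory.
Variable G : {group gT}.

Let ok A := [&& group_set A, A \subset G & G \subset 'N(A)]%g.

Let okG : ok G. Proof. by rewrite /ok groupP subxx normG. Qed.

Lemma norm_pow_subgroup A : G \subset 'N(A)%g -> G \subset 'N(pow_subgroup A)%g.
Proof.
move=> nAG; apply: subset_trans (norm_gen _); apply/subsetP=> x Gx.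
rewrite inE; apply/subsetP=> _ /imsetP[_ /imsetP[h Ah ->] ->].
rewrite conjXg; apply: (imset_f (fun h => h ^+ p)%g).
by rewrite memJ_norm // (subsetP nAG).
Qed.

Let ok_next A B : ok A -> ok B -> ok ([~: G, A] * pow_subgroup B)%g.
Proof.
case/and3P=> gA sAG nAG /and3P[gB sBG nBG].
have nR : G \subset 'N([~: G, A])%g by rewrite normsR // normG.
have sP : pow_subgroup B \subset G.
  by rewrite gen_subG; apply/subsetP=> _ /imsetP[h Bh ->];
    rewrite groupX // (subsetP sBG).
have sR : [~: G, A]%g \subset G.
  exact: subset_trans (commgS _ sAG) (der_sub 1 G).
rewrite /ok mul_subG // normsM ?norm_pow_subgroup // !andbT.
by apply/comm_group_setP/esym/normC/(subset_trans sP nR).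
Qed.

Let ok_plcs i : ok (plcs G i).
Proof.
rewrite /plcs; move: {2}i => j; elim: i j => [|i IH] j.
  by case: j => [|[|j]] //=; rewrite nth_nil.
rewrite /= nth_rcons; case: ifP => // _; case: eqP => // _.
exact: ok_next.
Qed.

Lemma plcs_group_set i : group_set (plcs G i).
Proof. by case/and3P: (ok_plcs i). Qed.
Canonical plcs_group i := Group (plcs_group_set i).

Lemma plcs_normal i : (plcs G i <| G)%g.
Proof. by apply/andP; case/and3P: (ok_plcs i). Qed.

Lemma pow_subgroupS A (B : {set gT}) :
  A \subset B -> pow_subgroup A \subset pow_subgroup B.
Proof. by move=> sAB; rewrite genS // imsetS. Qed.

Lemma plcsS i j : 1 < p -> i <= j -> plcs G j \subset plcs G i.
Proof.
move=> p_gt1; elim/ltn_ind: j i => -[|j] IH i.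
  by rewrite leqn0 => /eqP->.
rewrite leq_eqVlt => /orP[/eqP-> // | le_ij].
apply: subset_trans (IH j _ i _) => //.
case: j {i le_ij} IH => [|[|j]] IH //; first exact: normal_sub (plcs_normal _).
rewrite [X in _ \subset pred_of_set X]plcsE // [plcs G j.+3]plcsE //=.
apply: mulgSS; first by apply: commgS; apply: IH.
apply: pow_subgroupS; apply: IH; first exact: ceil_divn_lt.
have p0 := ltnW p_gt1.
by rewrite ceil_divn_leq // (leq_trans (leqnSn _)) // -ceil_divn_leq.
Qed.

Lemma commg_plcs i : 1 < p -> 0 < i -> [~: G, plcs G i]%g \subset plcs G i.+1.
Proof. by move=> p_gt1 i_gt0; rewrite (plcsE _ (i := i.+1)) //= mulG_subl. Qed.

Lemma pow_plcs i : 1 < p -> 0 < i ->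
  pow_subgroup (plcs G i) \subset plcs G i.+1.
Proof.
move=> p_gt1 i_gt0; rewrite (plcsE _ (i := i.+1)) //.
apply: subset_trans (mulG_subr _ _); apply/pow_subgroupS/plcsS => //.
by rewrite -ltnS ceil_divn_lt.
Qed.

Lemma plcs_abelem j : prime p -> 0 < j ->
  (p.-abelem (plcs G j / plcs G j.+1))%g.
Proof.
move=> p_pr j_gt0; have p_gt1 := prime_gt1 p_pr.
have nKH : plcs G j \subset 'N(plcs G j.+1)%g.
  apply: subset_trans (normal_sub (plcs_normal j)) _.
  exact: normal_norm (plcs_normal _).
rewrite abelemE //; apply/andP; split.
  rewrite sub_der1_abelian // (subset_trans _ (commg_plcs p_gt1 j_gt0)) //.
  exact/commSg/normal_sub/plcs_normal.
apply/exponentP=> _ /morphimP[x nx Hx ->].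
rewrite -morphX //= coset_id // (subsetP (pow_plcs p_gt1 j_gt0)) //.
exact/mem_gen/imset_f.
Qed.

Lemma plcs_quotient_isog j : prime p -> 0 < j ->
  (plcs G j / plcs G j.+1 \isog [set: 'rV['F_p]_(p_degree G j)])%g.
Proof.
move=> p_pr j_gt0; have abl := plcs_abelem p_pr j_gt0.
rewrite (isog_abelem_card _ abl) mx_Fp_abelem //= cardsT card_mx card_Fp //.
rewrite mul1n /p_degree -p_part part_pnat_id //.
by case/andP: abl.
Qed.

Lemma plcs_triv_ex : prime p -> (p.-group G)%g -> exists l, plcs G l.+1 == 1%g.
Proof.
move=> p_pr pG; have p_gt1 := prime_gt1 p_pr.
have [i0 min_i0] : exists i, forall j, #|plcs G i| <= #|plcs G j|.
  have ex : exists m, `[< exists i, #|plcs G i| = m >].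
    by exists #|plcs G 0|; apply/asboolP; exists 0.
  case: (ex_minnP ex) => m /asboolP[i <-] min_m; exists i => j.
  by apply: min_m; apply/asboolP; exists j.
pose H := plcs_group i0.
have eqH j : i0 <= j -> plcs G j = H.
  by move=> le_ij; apply/eqP; rewrite eqEcard plcsS //= min_i0.
have defH : H = ([~: G, H] * pow_subgroup H)%g :> {set gT}.
  have p_gt0 := ltnW p_gt1.
  have lt_i : i0.+1 < i0.+2 * p by apply: leq_pmulr.
  have eq_c : ceil_divn (i0.+2 * p) p = i0.+2.
    by rewrite /ceil_divn dvdn_mull // addn0 mulnK.
  move: (i0.+2 * p) lt_i eq_c => m lt_i eq_c.
  have m_gt1 : 1 < m by apply: leq_ltn_trans lt_i.
  have le_m : i0 <= m by apply: leq_trans (ltnW lt_i).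
  have le_m1 : i0 <= m.-1 by rewrite -ltnS (ltn_predK lt_i) ltnW.
  have := plcsE G p_gt1 m_gt1.
  by rewrite eq_c (eqH m le_m) (eqH _ le_m1) (eqH _ (leqW (leqnSn _))).
exists i0; rewrite eqH ?leqnSn //.
have nHG : G \subset 'N(H)%g := normal_norm (plcs_normal i0).
have sHG : H \subset G := normal_sub (plcs_normal i0).
have nilG := pgroup_nil pG.
move/forallP: (nilG) => /(_ H); rewrite subsetI sHG /= => /implyP; apply.
have pH := pgroupS sHG pG.
rewrite commGC.
have sR : [~: G, H]%g \subset H by rewrite commg_subr.
have nRH : H \subset 'N([~: G, H])%g.
  by apply: subset_trans sHG _; rewrite normsR // normG.
rewrite -quotient_sub1 //.
have abQ : abelian (H / [~: G, H])%g.
  by rewrite sub_der1_abelian // commSg.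
have pQ := quotient_pgroup [~: G, H] pH.
have sH : (H / [~: G, H] \subset 'Phi(H / [~: G, H]))%g.
  rewrite (Phi_Mho pQ abQ) (MhoE _ pQ) expn1.
  have -> : (H / [~: G, H] = pow_subgroup H / [~: G, H])%g.
    by rewrite -(quotientMidl _ (pow_subgroup H)) -defH.
  have sXH : [set (h ^+ p)%g | h in H] \subset H.
    by apply/subsetP=> _ /imsetP[h Hh ->]; rewrite groupX.
  rewrite quotient_gen ?(subset_trans sXH) // gen_subG.
  apply/subsetP=> _ /morphimP[_ _ /imsetP[h Hh ->] ->].
  have nh : h \in 'N([~: G, H])%g by rewrite (subsetP nRH).
  by rewrite morphX //; apply/mem_gen/imset_f/mem_quotient.
apply: contraLR sH; rewrite subG1 => ntQ.
by have /andP[] := Phi_proper ntQ.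
Qed.

Lemma plcs_lengthP : prime p -> (p.-group G)%g ->
  plcs G (plcs_length G).+1 = 1%g
  /\ forall l, plcs G l.+1 = 1%g -> plcs_length G <= l.
Proof.
move=> p_pr pG; rewrite /plcs_length; case: pselect => [ex|]; last first.
  by case; apply: plcs_triv_ex.
by case: ex_minnP => l /eqP-> min_l; split=> // k /eqP/min_l.
Qed.

End Theory.
End PLowerCentralSeries.

Definition delta (R : realType) (p : nat) (gT : finGroupType)
    (A : {set gT}) : R :=
  let r := p_degree p A in
  let l := plcs_length p A in
  ((\sum_(1 <= j < l.+1) j * r j)%N%:R ^+ 2
   / (\sum_(1 <= j < l.+1) j ^ 2 * r j)%N%:R)%R.
Arguments delta R p {gT} A.

(* Main.v *)
(** Filter the group algebra F_p[G] by weights: [I_m] is spanned by the products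
    of elements [g - 1], where [g] in Gamma_i has weight i.  These are ideals with
    I_a I_b inside I_(a+b).  Peeling off generators one at a time, from the top of the
    p-lower central series down, writes [I_m] in terms of the ordered
    products of the [(g_k - 1)^a_k], a_k < p (Jennings); hence [I_m = 0] for m
    larger than S = (p-1) sum_j j r_j, and the codimension of [I_m] is at most the
    number of exponent families of weight less than m.  With 3m > S, the product
    of three elements of [I_m] vanishes, so the slice rank is at most
    three times this codimension, which Hoeffding's inequality bounds for m near S/3.

    Peeling uses [Gamma_i, Gamma_j] inside Gamma_(i+j).  By the three subgroups
    lemma and induction this reduces to [x^p, y], i.e. to (c x)^p = x^p when c lies in a
    normal subgroup of exponent p whose p-th iterated commutator with x is
    trivial.  That is again read off the weight filtration, of the smaller subgroup:
    u |-> (c x) u x^-1 - u raises weights by one, and its p-th power maps 1 to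
    (c x)^p x^-p - 1, so that (c x)^p x^-p has weight at least p. *)

From HB Require Import structures.
Require Import Defs.
From mathcomp Require Import all_boot all_order all_fingroup all_algebra.
From mathcomp Require Import all_solvable all_character.
From mathcomp Require Import zify ring lra.
From mathcomp Require Import boolp reals normedtype sequences exp derive realfun.

Set Implicit Arguments.
Unset Strict Implicit.
Unset Printing Implicit Defensive.
Import Order.TTheory GRing.Theory Num.Theory numFieldNormedType.Exports.
Local Open Scope ring_scope.

(** * Groups filtered by weights, and peeling off generators one at a time *)

Section PSeries.

Variables (p : nat) (gT : finGroupType).
Hypothesis p_pr : prime p.
Implicit Type N : nat -> {group gT}.

(** Copying [N 1] to index 0 makes the case [i = 0] of [p_seriesR] say that every term is normal in
    the whole group. *)
Record p_series (N : nat -> {group gT}) : Prop := PSeries {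
  p_series01 : N 0%N = N 1%N;
  p_seriesS : forall i j, (i <= j)%N -> N j \subset N i;
  p_seriesR : forall i j, [~: N i, N j]%g \subset N (i + j)%N;
  p_seriesX : forall i g, g \in N i -> (g ^+ p)%g \in N (p * i)%N }.

Definition series_cap (N : nat -> {group gT}) (H : {group gT}) i := (N i :&: H)%G.

Lemma p_series_cap N H : p_series N -> p_series (series_cap N H).
Proof.
move=> [N01 NS NR NX]; rewrite /series_cap; split=> [|i j le_ij|i j|i g].
- by rewrite N01.
- by rewrite setSI ?NS.
- rewrite subsetI (subset_trans (commgSS (subsetIl _ _) (subsetIl _ _))) //=.
  by apply: subset_trans (commgSS (subsetIr _ _) (subsetIr _ _)) (der_sub 1 H).
by rewrite !inE => /andP[Ng Hg]; rewrite NX //= groupX.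
Qed.

Definition peels (N : nat -> {group gT}) (j : nat) (g : gT) (H : {group gT}) :=
  [/\ (0 < j)%N /\ N j = N 0%N, g \in N 0%N, (H <| N 0%N)%g,
      (forall i, (j < i)%N -> N i \subset H) & (#|N 0%N : H|%g = p /\ g \notin H)].

Section Peel.

Variables (N : nat -> {group gT}) (j : nat) (g : gT) (H : {group gT}).
Hypotheses (serN : p_series N) (peelN : peels N j g H).

Let M := series_cap N H.

Lemma peel_cap0 : M 0%N = H.
Proof. by case: peelN => _ _ nH _ _; apply/val_inj/setIidPr/normal_sub. Qed.

Lemma peel_low i : (i <= j)%N -> N i = N 0%N.
Proof.
case: peelN => -[_ Nj] _ _ _ _ le_ij; apply/val_inj/eqP; rewrite eqEsubset /= -{2}Nj.
by rewrite !(p_seriesS serN).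
Qed.

Lemma peel_capE i : M i = if (i <= j)%N then H else N i.
Proof.
case: leqP => [/peel_low Ni | lt_ji]; first by rewrite /M /series_cap Ni; apply: peel_cap0.
by case: peelN => _ _ _ sNH _; apply/val_inj/setIidPl/sNH.
Qed.

Lemma peel_decomp x : x \in N 0%N -> exists s h, h \in H /\ x = (h * g ^+ s)%g.
Proof.
case: peelN => _ Ng nH _ [iH nHg] Nx.
have maxH : maximal H (N 0%N).
  by apply: p_index_maximal (normal_sub nH) _; rewrite iH.
rewrite -(mulg_normal_maximal nH maxH (H := <[g]>%G)) ?cycle_subG // in Nx.
by case/mulsgP: Nx => h _ Hh /cycleP[s ->] ->; exists s, h.
Qed.

Lemma card_peel : #|N 0%N| = (p * #|H|)%N.
Proof.
have [_ _ nH _ [iH _]] := peelN.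
by rewrite -(Lagrange (normal_sub nH)) iH mulnC.
Qed.

End Peel.

(** Since [N 0] modulo [N j.+1] is elementary abelian, the line spanned by the image of [g] has a
    complement there; [H] is its preimage. *)
Lemma exists_peel N j g : p_series N -> (0 < j)%N -> N j = N 0%N ->
  g \in N 0%N -> g \notin N j.+1 -> exists H, peels N j g H.
Proof.
move=> serN j_gt0 Nj Ng Ng'.
have p_gt1 := prime_gt1 p_pr.
have nKN : N 0%N \subset 'N(N j.+1)%g.
  by rewrite -commg_subr; apply: (p_seriesR serN 0 j.+1).
have sKN : N j.+1 \subset N 0%N by apply: (p_seriesS serN).
have abQ : (p.-abelem (N 0%N / N j.+1))%g.
  rewrite abelemE //; apply/andP; split.
    rewrite sub_der1_abelian //; have := p_seriesR serN j j; rewrite Nj => sRN.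
    by apply: subset_trans sRN _; apply: (p_seriesS serN) => //; lia.
  apply/exponentP=> _ /morphimP[x nx Nx ->].
  rewrite -morphX //= coset_id //.
  have: (x ^+ p)%g \in N (p * j)%N by apply: (p_seriesX serN); rewrite // Nj.
  by apply: subsetP; apply: (p_seriesS serN) => //; nia.
have Qg : coset (N j.+1) g \in (N 0%N / N j.+1)%g by apply: mem_quotient.
have ntg : coset (N j.+1) g != 1%g.
  by apply: contra Ng' => /eqP/coset_idr; apply; apply: (subsetP nKN).
have [B [sBQ cardB defQ]] := p_abelem_split1 abQ Qg.
have [_ _ _ tiB] := dprodP defQ.
exists (coset (N j.+1) @*^-1 B)%G; split=> //.
- rewrite -(quotientGK (G := N 0%N) (H := N j.+1)); last by apply/andP.
  rewrite cosetpre_normal /normal sBQ /=.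
  exact: sub_abelian_norm (abelem_abelian abQ) _.
- move=> i lt_ji; apply: subset_trans (p_seriesS serN lt_ji) _.
  by apply: sub_cosetpre.
split.
  rewrite -[X in #|X : _|%g](quotientGK (G := N 0%N) (H := N j.+1)); last by apply/andP.
  rewrite index_cosetpre -divgS // cardB (abelem_order_p abQ Qg ntg).
  have p_dv : (p %| #|N 0%N / N j.+1|%g)%N.
    by rewrite -(abelem_order_p abQ Qg ntg) order_dvdG.
  rewrite -{1}(divnK p_dv) mulKn // divn_gt0 ?prime_gt0 //.
  exact: dvdn_leq p_dv.
apply: contra ntg => /morphpreP[_ Bg].
by apply/eqP/set1gP; rewrite -tiB inE cycle_id.
Qed.

Inductive peel_chain : (nat -> {group gT}) -> seq (nat * gT) -> Prop :=
| peel_nil N : (forall i, N i = 1%G) -> peel_chain N [::]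
| peel_cons N j g H ws : peels N j g H -> peel_chain (series_cap N H) ws ->
    peel_chain N ((j, g) :: ws).

(** Induction on the order of the group. The second part, that any element can be peeled at its
    exact weight, is what [aug_mem] needs. *)
Lemma exists_peel_chain N : p_series N -> (exists l, N l = 1%G) ->
  (exists ws, peel_chain N ws)
  /\ forall a g, g \in N a -> g \notin N a.+1 ->
     exists ws, peel_chain N ws /\ (a, g) \in ws.
Proof.
have [k] := ubnP #|N 0%N|; elim: k N => // k IH N; rewrite ltnS => le_Nk serN [l Nl].
have [N0 | ntN] := eqVneq (N 0%N) 1%G.
  have N1 i : N i = 1%G.
    by apply/val_inj/trivgP; have := p_seriesS serN (leq0n i); rewrite N0.
  split; first by exists [::]; apply: peel_nil.
  by move=> a g; rewrite !N1 => ->.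
have [j j_gt0 [Nj Nj']] : exists2 j, (0 < j)%N & N j = N 0%N /\ N j.+1 != N 0%N.
  have ex : exists j, N j.+1 != N 0%N.
    exists l; rewrite eq_sym; apply: contra ntN => /eqP->.
    by rewrite -val_eqE /= -subG1; have := p_seriesS serN (leqnSn l); rewrite Nl.
  case: (ex_minnP ex) => -[|j] Nj min_j.
    by rewrite (p_series01 serN) eqxx in Nj.
  exists j.+1 => //; split=> //; apply/eqP/negPn/negP => /min_j.
  by rewrite ltnn.
have step g H : peels N j g H ->
  (exists ws, peel_chain (series_cap N H) ws)
  /\ forall a x, x \in series_cap N H a -> x \notin series_cap N H a.+1 ->
     exists ws, peel_chain (series_cap N H) ws /\ (a, x) \in ws.
  move=> pl; apply: IH; last 2 first.
  - exact: p_series_cap.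
  - by exists l; apply/val_inj/trivgP; rewrite /= Nl subsetIl.
  apply: leq_trans le_Nk; rewrite (card_peel pl) (peel_capE serN pl) /=.
  by rewrite -[X in (X < _)%N]mul1n ltn_pmul2r ?cardG_gt0 ?prime_gt1 // p_pr.
have [g0 Ng0 Ng0'] : exists2 g, g \in N 0%N & g \notin N j.+1.
  by apply/subsetPn; apply: contra Nj' => sN; rewrite -val_eqE eqEsubset /= sN p_seriesS.
have [H0 pl0] := exists_peel serN j_gt0 Nj Ng0 Ng0'.
split; first by have [[ws Mws] _] := step _ _ pl0; exists ((j, g0) :: ws); apply: peel_cons Mws.
move=> a g Na Na'.
have N0g : g \in N 0%N by apply: subsetP Na; apply: (p_seriesS serN).
have [N'g | N'g] := boolP (g \in N j.+1); last first.
  have [H pl] := exists_peel serN j_gt0 Nj N0g N'g.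
  have [[ws Mws] _] := step _ _ pl; exists ((j, g) :: ws); split.
    exact: peel_cons Mws.
  have le_aj : (a <= j)%N.
    rewrite leqNgt; apply: contra N'g => lt_ja.
    by apply: subsetP Na; apply: (p_seriesS serN).
  have le_ja : (j <= a)%N.
    rewrite leqNgt; apply: contra Na' => lt_aj.
    have: g \in N j by rewrite Nj.
    by apply: subsetP; apply: (p_seriesS serN).
  by rewrite inE -pair_eqE /= eqn_leq le_aj le_ja eqxx.
have lt_ja : (j < a)%N.
  rewrite ltnNge; apply: contra Na' => le_aj.
  by apply: subsetP N'g; apply: (p_seriesS serN).
have [_ stepa] := step _ _ pl0.
have [||ws [Mws ag]] := stepa a g.
- by rewrite (peel_capE serN pl0) leqNgt lt_ja.
- by rewrite (peel_capE serN pl0) leqNgt ltnS ltnW.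
by exists ((j, g0) :: ws); split; [apply: peel_cons Mws | rewrite inE ag orbT].
Qed.

Lemma peel_chain_card N ws i : peel_chain N ws -> p_series N ->
  #|N i| = (p ^ count (fun w => i <= w.1)%N ws)%N.
Proof.
move=> chN; elim: {N ws} chN i => [N N1 | N j g H ws pl _ IH] i serN.
  by rewrite N1 cards1.
have := IH i (p_series_cap H serN); rewrite (peel_capE serN pl) /=.
case: leqP => [le_ij | lt_ji] //.
rewrite (peel_low serN pl) // (card_peel pl) => ->.
by rewrite expnD expn1.
Qed.

Lemma peel_chain_mem N ws w : peel_chain N ws -> p_series N -> w \in ws -> w.2 \in N w.1.
Proof.
elim=> {N ws} [N N1 // | N j g H ws pl _ IH] serN.
rewrite inE => /predU1P[->/= | wws].
  by have [[_ ->] ] := pl.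
by have /setIP[] := IH (p_series_cap H serN) wws.
Qed.

End PSeries.

(** * Ring identities, mostly in characteristic p *)

(** By Pascal's rule, and since p divides the inner binomial coefficients ['C(p, i)], every
    [(-1)^i 'C(p.-1, i)] with [i < p] is 1 in characteristic p. *)
Lemma exprB1_pred_pchar (A : nzRingType) p (x : A) :
  p \in [pchar A] -> (x - 1) ^+ p.-1 = \sum_(i < p) x ^+ i.
Proof.
move=> pA; have p_pr := pcharf_prime pA.
have sgnC i : (i < p)%N -> (-1) ^+ i *+ 'C(p.-1, i) = 1 :> A.
  elim: i => [|i IH] lt_ip; first by rewrite bin0 expr0.
  have: (-1) ^+ i.+1 *+ 'C(p.-1.+1, i.+1) = 0 :> A.
    rewrite (prednK (prime_gt0 p_pr)) -mulr_natr.
    have /dvdnP[k ->] : (p %| 'C(p, i.+1))%N by rewrite prime_dvd_bin.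
    by rewrite natrM (pcharf0 pA) !mulr0.
  rewrite binS mulrnDr => /(canRL (addrK _)) ->; rewrite sub0r exprS mulN1r.
  by rewrite mulNrn opprK IH // ltnW.
rewrite (exprBn_comm _ (commr1 x)) (prednK (prime_gt0 p_pr)).
rewrite (reindex_inj rev_ord_inj) /=; apply: eq_bigr => i _.
have lt_ip := ltn_ord i.
rewrite expr1n mulr1 -mulrnAl sgnC ?mul1r; last by lia.
by congr (_ ^+ _); lia.
Qed.

(** A collection step: for [k] the commutator of [a] and [b], it moves [a - 1] past [b - 1] at the
    cost of terms containing [k - 1]. *)
Lemma mulB1_comm (A : nzRingType) (a b k y : A) : a * b = b * a * k ->
  (a - 1) * ((b - 1) * y)
  = (b - 1) * ((a - 1) * y + a * ((k - 1) * y)) + a * ((k - 1) * y).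
Proof.
move=> ab; have -> : (a - 1) * y + a * ((k - 1) * y) = a * k * y - y.
  by rewrite mulrA -mulrDl mulrBr mulr1 addrC addrA subrK mulrBl mul1r.
rewrite mulrA mulrBr mulr1 [(a - 1) * b]mulrBl mul1r ab.
rewrite [RHS]addrC mulrA mulrBr mulr1 [(b - 1) * _]mulrBr.
rewrite [(b - 1) * (_ * _)]mulrBl [(b - 1) * y]mulrBl !mul1r !mulrBl !mul1r !mulrA.
set t1 := b * a * k * y; set t2 := b * y; set t3 := a * y; set t4 := a * k * y.
by rewrite addrC [t1 - t4 - _]addrAC addrA subrK !opprB !addrA [t1 - t2 + y]addrAC.
Qed.

(* Newton's formula [(1 + D)^n = sum_k 'C(n, k) D^k] for the additive operator  *)
(* [D u = a u b - u].                                                             *)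
Lemma twist_newton (A : nzRingType) (a b u : A) n :
  a ^+ n * u * b ^+ n
  = \sum_(k < n.+1) iter k (fun v => a * v * b - v) u *+ 'C(n, k).
Proof.
set D := fun v => a * v * b - v; elim: n => [|n IH].
  by rewrite big_ord1 mul1r mulr1.
have -> : a ^+ n.+1 * u * b ^+ n.+1 = a * (a ^+ n * u * b ^+ n) * b.
  by rewrite exprS exprSr !mulrA.
rewrite IH mulr_sumr mulr_suml.
have DE k : a * (iter k D u *+ 'C(n, k)) * b
            = iter k D u *+ 'C(n, k) + iter k.+1 D u *+ 'C(n, k).
  by rewrite mulrnAr mulrnAl -mulrnDl /= /D addrC subrK.
rewrite (eq_bigr _ (fun (k : 'I_n.+1) _ => DE k)) big_split /=.
rewrite [RHS]big_ord_recl bin0.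
have -> : \sum_(k < n.+1) iter (lift ord0 k) D u *+ 'C(n.+1, lift ord0 k)
  = \sum_(k < n.+1) iter k.+1 D u *+ 'C(n, k.+1)
    + \sum_(k < n.+1) iter k.+1 D u *+ 'C(n, k).
  by rewrite -big_split; apply: eq_bigr => k _ /=; rewrite -mulrnDr.
rewrite addrA; congr (_ + _).
transitivity (\sum_(k < n.+2) iter k D u *+ 'C(n, k)).
  by rewrite [RHS]big_ord_recr /= (bin_small (ltnSn n)) mulr0n addr0.
by rewrite big_ord_recl !bin0.
Qed.

Lemma twist_pchar (A : nzRingType) p (a b u : A) : p \in [pchar A] ->
  iter p (fun v => a * v * b - v) u = a ^+ p * u * b ^+ p - u.
Proof.
case: p => [|q] pA; have p_pr := pcharf_prime pA; first by [].
rewrite twist_newton big_ord_recr big_ord_recl /= bin0 binn !mulr1n.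
rewrite [X in _ + X + _]big1 ?addr0; last first.
  move=> i _; have /dvdnP[k ->] : (q.+1 %| 'C(q.+1, bump 0 i))%N.
    by rewrite prime_dvd_bin // /bump ltnS /= ltn_ord.
  by rewrite mulnC mulrnA (mulrn_pchar pA) mul0rn.
by rewrite addrAC subrr add0r.
Qed.

(* The number of families [a_i < p] with [sum_i a_i w_i < m].                     *)
Fixpoint num_below (p : nat) (ws : seq nat) (m : nat) : nat :=
  if ws is w :: ws' then \sum_(a < p) num_below p ws' (m - w * a) else (0 < m)%N.

(** * The weight filtration and Jennings's normal form *)

Section AugmentationFiltration.

Variables (p : nat) (gT : finGroupType) (A : nzRingType) (e : gT -> A).
Hypotheses (pA : p \in [pchar A]) (e1 : e 1%g = 1)
           (eM : forall x y, e (x * y)%g = e x * e y).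

Let p_pr : prime p := pcharf_prime pA.
Implicit Types (N M : nat -> {group gT}) (m k : nat).

Lemma expr_e g n : e g ^+ n = e (g ^+ n)%g.
Proof. by elim: n => [|n IH]; rewrite ?expr0 ?e1 // exprS expgS eM IH. Qed.

(* The elements of weight at least m, where the elements of N i have weight i;  *)
(* sums suffice, as multiples by the prime field are iterated sums.             *)
Inductive aug (N : nat -> {group gT}) : nat -> A -> Prop :=
| aug_one : aug N 0 1
| aug_zero m : aug N m 0
| aug_add m x y : aug N m x -> aug N m y -> aug N m (x + y)
| aug_opp m x : aug N m x -> aug N m (- x)
| aug_mul i m g x : g \in N i -> aug N m x -> aug N (i + m) ((e g - 1) * x)
| aug_weak m k x : (k <= m)%N -> aug N m x -> aug N k x.

Lemma aug_group N m g x : g \in N 0%N -> aug N m x -> aug N m (e g * x).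
Proof.
move=> Ng Nx; rewrite -[e g](subrK 1) mulrDl mul1r; apply: aug_add => //.
exact: (aug_mul (i := 0)).
Qed.

Lemma aug_prod N m k x y : aug N m x -> aug N k y -> aug N (m + k) (x * y).
Proof.
move=> Nx Ny; elim: {m x} Nx => [|m|m x1 x2 _ IH1 _ IH2|m x _ IH|i m g x Ng _ IH|].
- by rewrite add0n mul1r.
- by rewrite mul0r; apply: aug_zero.
- by rewrite mulrDl; apply: aug_add.
- by rewrite mulNr; apply: aug_opp.
- by rewrite -mulrA -addnA; apply: aug_mul.
by move=> m l x le_lm _; apply: aug_weak; rewrite leq_add2r.
Qed.

Lemma aug_mono (M N : nat -> {group gT}) m x :
  (forall i, M i \subset N i) -> aug M m x -> aug N m x.
Proof.
move=> sMN; elim=> {m x} [|m|m x y _ Nx _|m x _|i m g x Mg _|m k x le_km _].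
- exact: aug_one.
- exact: aug_zero.
- exact: aug_add.
- exact: aug_opp.
- by apply: aug_mul; apply: (subsetP (sMN i)).
exact: aug_weak.
Qed.

Lemma aug_gen N i g : g \in N i -> aug N i (e g - 1).
Proof.
move=> Ng; rewrite -[_ - _]mulr1 -[i in aug _ i]addn0.
exact: aug_mul Ng (aug_one N).
Qed.

Lemma aug_trivial_eq0 (N : nat -> {group gT}) m x :
  (forall i, N i = 1%G) -> aug N m x -> (0 < m)%N -> x = 0.
Proof.
move=> N1; elim=> {m x} // [m x y _ IHx _ IHy|m x _ IH|i m g x|m k x le_km _ IH].
- by move=> m_gt0; rewrite IHx // IHy // addr0.
- by move=> m_gt0; rewrite IH // oppr0.
- by rewrite N1 => /set1P->; rewrite e1 subrr mul0r.
by move=> k_gt0; apply: IH; apply: leq_trans le_km.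
Qed.

Lemma aug_trivial_scalar (N : nat -> {group gT}) m x :
  (forall i, N i = 1%G) -> aug N m x -> exists k, x = 1 *+ k.
Proof.
move=> N1; elim=> {m x} //.
- by exists 1%N.
- by exists 0%N.
- by move=> m x y _ [k ->] _ [l ->]; exists (k + l)%N; rewrite mulrnDr.
- move=> m x _ [k ->]; exists (k * p.-1)%N; apply/eqP.
  rewrite eq_sym -addr_eq0 -mulrnDr -mulnSr (prednK (prime_gt0 p_pr)).
  by rewrite mulnC mulrnA (pcharf0 pA) mul0rn.
by move=> i m g x; rewrite N1 => /set1P-> _ _; exists 0%N; rewrite e1 subrr mul0r.
Qed.

Section Peel.

Variables (N : nat -> {group gT}) (j : nat) (g : gT) (H : {group gT}).
Hypotheses (serN : p_series p N) (peelN : peels p N j g H).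

Let M := series_cap N H.

Let M0 : M 0%N = H := peel_cap0 peelN.

(* Elements of the form [u_0 + (g - 1) u_1 + ... + (g - 1)^(a-1) u_(a-1)] with  *)
(* [u_b] in the filtration of H, of weight at least [m - j b].                   *)
Fixpoint horner_aug (a m : nat) (x : A) : Prop :=
  if a is a'.+1 then
    exists u y, [/\ aug M m u, horner_aug a' (m - j) y & x = u + (e g - 1) * y]
  else x = 0.

Lemma horner_aug0 a m : horner_aug a m 0.
Proof.
elim: a m => // a IH m; exists 0, 0.
by split; rewrite ?mulr0 ?addr0 //; apply: aug_zero.
Qed.

Lemma horner_aug_add a m x y :
  horner_aug a m x -> horner_aug a m y -> horner_aug a m (x + y).
Proof.
elim: a m x y => [|a IH] m x y /=; first by move=> -> ->; rewrite addr0.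
case=> u [x' [Mu Rx ->]] [v [y' [Mv Ry ->]]]; exists (u + v), (x' + y').
by split; [apply: aug_add | apply: IH | rewrite mulrDr addrACA].
Qed.

Lemma horner_aug_opp a m x : horner_aug a m x -> horner_aug a m (- x).
Proof.
elim: a m x => [|a IH] m x /=; first by move=> ->; rewrite oppr0.
case=> u [y [Mu Ry ->]]; exists (- u), (- y).
by split; [apply: aug_opp | apply: IH | rewrite opprD mulrN].
Qed.

Lemma horner_aug_weak a m k x :
  (k <= m)%N -> horner_aug a m x -> horner_aug a k x.
Proof.
elim: a m k x => // a IH m k x le_km [u [y [Mu Ry ->]]]; exists u, y.
split=> //; first exact: aug_weak Mu.
by apply: IH Ry; rewrite leq_sub2r.
Qed.

Lemma horner_augS a m x : horner_aug a m x -> horner_aug a.+1 m x.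
Proof.
elim: a m x => [|a IH] m x; first by move=> ->; apply: horner_aug0.
by case=> u [y [Mu Ry ->]]; exists u, y; split=> //; apply: IH.
Qed.

Lemma horner_aug_mulg a m x :
  horner_aug a m x -> horner_aug a.+1 (j + m) ((e g - 1) * x).
Proof.
by exists 0, x; split; rewrite ?add0r ?addKn //; apply: aug_zero.
Qed.

(** By [mulB1_comm], passing [h] across [g] costs a factor [e [~ h, g] - 1], and [[~ h, g]] lies in
    [M (i + j)]; induction on the number of Horner coefficients absorbs it. *)
Lemma horner_aug_capmul a i m h x : h \in M i ->
  horner_aug a m x -> horner_aug a (i + m) ((e h - 1) * x).
Proof.
elim: a i m h x => [|a IH] i m h x Mh; first by move=> ->; rewrite /= mulr0.
case=> u [y [Mu Ry ->]]; rewrite mulrDr; apply: horner_aug_add.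
  by exists ((e h - 1) * u), 0; rewrite mulr0 addr0;
    split=> //; [apply: aug_mul | apply: horner_aug0].
have [[_ Nj] Ng nH _ _] := peelN.
have Mc : [~ h, g]%g \in M (i + j)%N.
  have [NiH Hh] := setIP Mh; rewrite inE.
  rewrite (subsetP (p_seriesR serN i j)) ?mem_commg ?Nj //=.
  rewrite commgEl groupM ?groupV // memJ_norm // (subsetP (normal_norm nH)) //.
pose c := (e [~ h, g]%g - 1) * y.
have Rc : horner_aug a (i + j + (m - j)) c by apply: IH.
have Rhc : horner_aug a (i + j + (m - j)) (e h * c).
  rewrite -[e h](subrK 1) mulrDl mul1r; apply: horner_aug_add => //.
  apply: (IH 0%N _ h c) => //.
  by rewrite M0; case/setIP: Mh.
have hg : e h * e g = e g * e h * e [~ h, g]%g by rewrite -!eM commgC.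
rewrite (mulB1_comm y hg); apply: horner_aug_add; last first.
  by apply: horner_augS; apply: horner_aug_weak Rhc; lia.
apply: (@horner_aug_weak _ (j + (i + (m - j)))%N); first by lia.
apply: horner_aug_mulg; apply: horner_aug_add; first exact: IH.
by apply: horner_aug_weak Rhc; lia.
Qed.

Lemma horner_aug_base a m u : aug M m u -> horner_aug a.+1 m u.
Proof.
by exists u, 0; rewrite mulr0 addr0; split=> //; apply: horner_aug0.
Qed.

Lemma horner_aug_top a m x : horner_aug a.+1 m x ->
  exists u y, [/\ aug M (m - j * a) u, horner_aug a m y
                & x = y + (e g - 1) ^+ a * u].
Proof.
elim: a m x => [|a IH] m x.
  case=> u [y [Mu -> ->]]; exists u, 0.
  by rewrite muln0 subn0 mulr0 addr0 add0r mul1r.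
case=> u [_ [Mu /IH[v [y [Mv Ry ->]]] ->]]; exists v, (u + (e g - 1) * y); split.
- by rewrite mulnS subnDA.
- by exists u, y.
by rewrite mulrDr addrA mulrA -exprS.
Qed.

(** In characteristic p, [(g - 1)^p = g^p - 1], and [g^p] has weight [p j > j], hence lies in [H]:
    the p-th power is absorbed by the constant coefficient. *)
Lemma horner_aug_wrap m x : horner_aug p.+1 m x -> horner_aug p m x.
Proof.
case/horner_aug_top=> u [y [Mu Ry ->]]; apply: horner_aug_add => //.
have [[j_gt0 Nj] Ng nH sNH _] := peelN.
have p_gt1 := prime_gt1 p_pr.
have -> : (e g - 1) ^+ p = e (g ^+ p)%g - 1.
  rewrite -(pFrobenius_autE pA) pFrobenius_autB_comm; last exact: commr1.
  by rewrite pFrobenius_aut1 pFrobenius_autE expr_e.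
rewrite -(prednK (prime_gt0 p_pr)); apply: horner_aug_base; rewrite prednK ?prime_gt0 //.
have Mgp : (g ^+ p)%g \in M (p * j)%N.
  have Ngp : (g ^+ p)%g \in N (p * j)%N by apply: (p_seriesX serN); rewrite // Nj.
  rewrite inE Ngp (subsetP (sNH (p * j)%N _)) //.
  by rewrite -[X in (X < _)%N]mul1n ltn_pmul2r.
apply: aug_weak (aug_mul Mgp Mu); lia.
Qed.

(** The Horner forms contain 1 and are stable under multiplication by [e k - 1]: write [k = h g^s]
    with [h] in [H] and treat the two factors separately. *)
Lemma aug_peel m x : aug N m x -> horner_aug p m x.
Proof.
have def_p := prednK (prime_gt0 p_pr).
have mulg1 n y : horner_aug p n y -> horner_aug p (j + n) ((e g - 1) * y).
  by move=> Ry; apply/horner_aug_wrap/horner_aug_mulg.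
have mulgX n s y : horner_aug p n y ->
    horner_aug p (j + n) ((e (g ^+ s)%g - 1) * y) /\ horner_aug p n (e (g ^+ s)%g * y).
  move=> Ry; elim: s => [|s [IH1 IH2]].
    by rewrite e1 subrr mul0r mul1r; split=> //; apply: horner_aug0.
  have R1 := mulg1 _ _ IH2.
  rewrite expgS eM; split.
    have -> : e g * e (g ^+ s)%g - 1 = (e g - 1) * e (g ^+ s)%g + (e (g ^+ s)%g - 1).
      by rewrite mulrBl mul1r addrA subrK.
    by rewrite mulrDl -mulrA; apply: horner_aug_add.
  rewrite -[e g](subrK 1) mulrDl mul1r mulrDl -mulrA; apply: horner_aug_add => //.
  by apply: horner_aug_weak R1; rewrite leq_addl.
elim=> {m x} [|m|m x y _ Rx _ Ry|m x _|i m k x Nk _ Rx|m k x le_km _].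
- by rewrite -def_p; apply: horner_aug_base; apply: aug_one.
- exact: horner_aug0.
- exact: horner_aug_add.
- exact: horner_aug_opp.
- have [[j_gt0 Nj] Ng nH sNH _] := peelN.
  case: (leqP i j) => [le_ij | lt_ji]; last first.
    by apply: horner_aug_capmul => //; rewrite /M (peel_capE serN peelN) leqNgt lt_ji.
  (* For [i <= j] one has [N i = N j], so [k] has in fact weight [j]. *)
  rewrite (peel_low serN peelN) // in Nk; have [s [h [Hh ->]]] := peel_decomp p_pr peelN Nk.
  apply: (@horner_aug_weak _ (j + m)%N); first by rewrite leq_add2r.
  have [R1 R2] := mulgX m s x Rx; rewrite eM.
  have -> : e h * e (g ^+ s)%g - 1 = (e h - 1) * e (g ^+ s)%g + (e (g ^+ s)%g - 1).
    by rewrite mulrBl mul1r addrA subrK.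
  rewrite mulrDl -mulrA; apply: horner_aug_add => //.
  by apply: horner_aug_capmul => //; rewrite /M (peel_capE serN peelN) leqnn.
exact: horner_aug_weak.
Qed.

(** Each element of [N 0] is [g^s h] for unique [s < p] and [h] in [H]: unique because no [g^k] with
    [0 < k < p] lies in [H], and existence follows by counting. *)
Lemma sum_peel :
  \sum_(x in N 0%N) e x = (\sum_(s < p) e g ^+ s) * \sum_(h in H) e h.
Proof.
have [_ Ng nH _ [iH nHg]] := peelN.
have sHN := normal_sub nH; have nHgg := subsetP (normal_norm nH) _ Ng.
pose f (u : 'I_p * gT) := (g ^+ u.1 * u.2)%g.
pose D := setX [set: 'I_p] (H : {set gT}).
have gX_notin k : (0 < k < p)%N -> (g ^+ k)%g \notin H.
  case/andP=> k_gt0 lt_kp; apply: contra nHg => Hgk.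
  apply: coset_idr => //; apply/eqP; rewrite -order_eq1 -dvdn1.
  have cop : coprime k p by rewrite coprime_sym prime_coprime // gtnNdvd.
  rewrite -(eqnP cop) dvdn_gcd !order_dvdn -!morphX //= coset_id // eqxx /=.
  have Qg : coset H g \in (N 0%N / H)%g by apply: mem_quotient.
  rewrite morphX //= -order_dvdn.
  by apply: dvdn_trans (order_dvdG Qg) _; rewrite card_quotient ?normal_norm // iH.
have injf : {in D &, injective f}.
  have wlogf (s t : nat) h h' : h \in H -> h' \in H -> (s <= t < p)%N ->
      (g ^+ s * h = g ^+ t * h')%g -> s = t /\ h = h'.
    move=> Hh Hk /andP[le_st lt_tp] eq_f.
    have def_h : h = (g ^+ (t - s) * h')%g.
      by apply: (mulgI (g ^+ s)%g); rewrite eq_f mulgA -expgD subnKC.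
    have Hts : (g ^+ (t - s))%g \in H.
      by rewrite -(groupMr _ Hk) -def_h.
    have ts0 : (t - s)%N = 0%N.
      apply/eqP; rewrite -leqn0 leqNgt; apply: contraL Hts => ts_gt0.
      by apply: gX_notin; rewrite ts_gt0 (leq_ltn_trans (leq_subr _ _)).
    by move: def_h; rewrite ts0 expg0 mul1g; split=> //; lia.
  move=> [s h] [t k]; rewrite !inE /= => Hh Hk eq_f.
  case/orP: (leq_total s t) => le_st.
    have [] := wlogf s t h k Hh Hk _ eq_f; first by rewrite le_st ltn_ord.
    by move=> /val_inj-> ->.
  have [] := wlogf t s k h Hk Hh _ (esym eq_f); first by rewrite le_st ltn_ord.
  by move=> /val_inj-> ->.
have -> : N 0%N = f @: D :> {set gT}.
  apply/eqP; rewrite eq_sym eqEcard card_in_imset // cardsX cardsT card_ord.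
  rewrite (card_peel peelN) leqnn andbT.
  apply/subsetP=> _ /imsetP[[s h]] /[!inE] /= Hh ->.
  by rewrite groupM ?groupX // (subsetP sHN).
rewrite big_imset //= mulr_suml.
under [RHS]eq_bigr do rewrite mulr_sumr.
rewrite (pair_big_dep predT (fun _ h => h \in H)) /=.
by apply: eq_big => [[s h]|[s h] _]; rewrite ?inE //= eM expr_e.
Qed.

End Peel.

Lemma peel_chain_sum N ws : peel_chain p N ws -> p_series p N ->
  \sum_(x in N 0%N) e x = \prod_(w <- ws) (e w.2 - 1) ^+ p.-1.
Proof.
elim=> {N ws} [N N1 | N j g H ws pl _ IH] serN.
  by rewrite N1 big_nil big_set1 e1.
rewrite (sum_peel pl) big_cons -exprB1_pred_pchar // -IH; last exact: p_series_cap.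
by rewrite (peel_capE serN pl).
Qed.

(** All Horner coefficients have weight at least [m - j (p - 1)], still above the largest weight
    possible in [H], so they vanish by induction. *)
Lemma peel_chain_aug_eq0 N ws m x : peel_chain p N ws -> p_series p N ->
  aug N m x -> (p.-1 * \sum_(w <- ws) w.1 < m)%N -> x = 0.
Proof.
move=> chN; elim: {N ws} chN m x => [N N1 | N j g H ws pl _ IH] m x serN.
  by rewrite big_nil muln0; apply: aug_trivial_eq0.
rewrite big_cons /= => /(aug_peel serN pl).
have serM := p_series_cap H serN.
have horner_eq0 a n y : horner_aug N j g H a n y ->
    (p.-1 * (\sum_(w <- ws) w.1) + j * a.-1 < n)%N -> y = 0.
  elim: a n y => [|a IHa] n y //= [u [z [Mu Rz ->]]] lt_n.
  rewrite (IH _ _ serM Mu) ?add0r; last by apply: leq_ltn_trans lt_n; apply: leq_addr.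
  case: a IHa Rz lt_n => [_ -> _|a IHa Rz lt_n]; first by rewrite mulr0.
  by rewrite (IHa _ _ Rz) ?mulr0 // ltn_subRL addnC -addnA -mulnSr.
move=> /horner_eq0 x0 lt_m; apply: x0; apply: leq_ltn_trans lt_m.
by rewrite mulnDr addnC [(j * _)%N]mulnC.
Qed.

Lemma aug_exp N m x n : aug N m x -> aug N (n * m) (x ^+ n).
Proof.
by move=> Nx; elim: n => [|n IH]; [apply: aug_one | rewrite exprS mulSn; apply: aug_prod].
Qed.

(* An ordered product of the [(g_i - 1) ^+ p.-1] equals the sum of all group     *)
(* elements; were [e g - 1] of larger weight than [g], it would vanish.            *)
Lemma aug_mem N m g : p_series p N -> (exists l, N l = 1%G) ->
  \sum_(x in N 0%N) e x != 0 ->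
  g \in N 0%N -> aug N m (e g - 1) -> g \in N m.
Proof.
move=> serN trivN sum_neq0 N0g augg.
suff: forall k, (k <= m)%N -> g \in N k by apply.
elim=> [|k IH] // lt_km; apply: contraNT sum_neq0 => N'g.
have [_ /(_ k g (IH (ltnW lt_km)) N'g)[ws [chN wsg]]] := exists_peel_chain p_pr serN trivN.
have p_gt1 := prime_gt1 p_pr.
rewrite (peel_chain_sum chN serN); apply/eqP.
apply: (peel_chain_aug_eq0 chN serN _ (ltnSn _)).
have Nws w : w \in ws -> aug N (p.-1 * w.1) ((e w.2 - 1) ^+ p.-1).
  by move=> /(peel_chain_mem chN serN) Nw; apply/aug_exp/aug_gen.
have augws s : {subset s <= ws} ->
    aug N (p.-1 * \sum_(w <- s) w.1) (\prod_(w <- s) (e w.2 - 1) ^+ p.-1).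
  elim: s => [|w s IHs] sub_s; first by rewrite !big_nil muln0; apply: aug_one.
  rewrite !big_cons mulnDr; apply: aug_prod; first by apply/Nws/sub_s/mem_head.
  by apply: IHs => v sv; apply: sub_s; rewrite inE sv orbT.
case/splitPr: wsg augws {Nws chN} => s1 s2 augws.
rewrite !big_cat !big_cons /= !mulnDr.
have aug1 := augws s1 (mem_subseq (prefix_subseq s1 _)).
have aug2 : aug N (p.-1 * \sum_(w <- s2) w.1) (\prod_(w <- s2) (e w.2 - 1) ^+ p.-1).
  by apply: augws => w s2w; rewrite mem_cat inE s2w !orbT.
(* The factor of [g] gets weight [p.-1 * k.+1] in place of [p.-1 * k], which takes the product
   beyond the maximal weight. *)
have augk : aug N (p.-1 * k.+1) ((e g - 1) ^+ p.-1).
  by apply/aug_exp/(aug_weak lt_km).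
apply: aug_weak (aug_prod aug1 (aug_prod augk aug2)).
by rewrite ltn_add2l ltn_add2r mulnS -[X in (X < _)%N]add0n ltn_add2r; lia.
Qed.

Definition spans_mod (B I : A -> Prop) (c : seq A) :=
  forall u, B u -> exists phi : nat -> nat, I (u - \sum_(i < size c) c`_i *+ phi i).

(** The coefficient of [(g - 1)^b] matters only modulo weight [m - j b]; adding up over [b < p]
    gives the recursion of [num_below]. *)
Lemma peel_chain_spans N ws m : peel_chain p N ws -> p_series p N ->
  exists c, size c = num_below p (unzip1 ws) m /\ spans_mod (aug N 0) (aug N m) c.
Proof.
move=> chN; elim: {N ws} chN m => [N N1 | N j g H ws pl _ IH] m serN.
  case: m => [|m].
    by exists [::]; split=> // u Nu; exists (fun _ => 0%N); rewrite big_ord0 subr0.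
  exists [:: 1]; split=> // u /(aug_trivial_scalar N1)[k ->].
  by exists (fun _ => k); rewrite big_ord1 subrr; apply: aug_zero.
have serM := p_series_cap H serN.
have sMN i : series_cap N H i \subset N i by apply: subsetIl.
have [[j_gt0 Nj] Ng _ _ _] := pl.
have horner_spans a n : exists c,
    size c = (\sum_(b < a) num_below p (unzip1 ws) (n - j * b))%N
    /\ spans_mod (horner_aug N j g H a 0) (aug N n) c.
  elim: a n => [|a IHa] n.
    exists [::]; rewrite big_ord0; split=> // u ->.
    by exists (fun _ => 0%N); rewrite big_ord0 subr0; apply: aug_zero.
  have [c [sz_c span_c]] := IHa (n - j)%N.
  have [d [sz_d span_d]] := IH n serM.
  exists (d ++ [seq (e g - 1) * x | x <- c]); split.
    rewrite size_cat size_map sz_c sz_d big_ord_recl muln0 subn0; congr (_ + _)%N.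
    by apply: eq_bigr => b _; rewrite -subnDA mulnS.
  move=> _ [u [y [Mu Ry ->]]].
  have [phi Mphi] := span_d _ Mu; have [psi Npsi] := span_c _ Ry.
  exists (fun i => if (i < size d)%N then phi i else psi (i - size d)%N).
  rewrite size_cat size_map big_split_ord /=.
  have -> (s : seq A) : \sum_(i < size d) (d ++ s)`_i *+ (if (i < size d)%N
      then phi i else psi (i - size d)%N) = \sum_(i < size d) d`_i *+ phi i.
    by apply: eq_bigr => i _; rewrite nth_cat ltn_ord.
  have -> : \sum_(i < size c) (d ++ [seq (e g - 1) * x | x <- c])`_(size d + i)
      *+ (if (size d + i < size d)%N then phi (size d + i)%N
          else psi (size d + i - size d)%N)
      = \sum_(i < size c) (e g - 1) * (c`_i *+ psi i).
    apply: eq_bigr => i _; rewrite nth_cat ltnNge leq_addr /= addKn.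
    by rewrite (nth_map 0) // mulrnAr.
  rewrite -mulr_sumr opprD addrACA -mulrBr; apply: aug_add.
    exact: aug_mono Mphi.
  apply: (@aug_weak _ (j + (n - j))%N); first by lia.
  by apply: aug_mul; rewrite // Nj.
have [c [sz_c span_c]] := horner_spans p m.
by exists c; split=> // u /(aug_peel serN pl)/span_c.
Qed.

(** Conjugation by [x] keeps weights and changes each factor [e n - 1] by a term in [e [~ n, x^-1] -
    1], one weight higher; the factor [c] adds a multiple of [e c - 1], of weight 1. *)
Lemma aug_twist N m (c x : gT) u : p_series p N -> c \in N 1%N ->
  (forall i n, n \in N i -> [~ n, x^-1]%g \in N i.+1) ->
  aug N m u -> aug N m.+1 (e (c * x)%g * u * e x^-1%g - u).
Proof.
move=> serN Nc Nx Nu; pose cj v := e x * v * e x^-1%g.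
have cj1 : e x * e x^-1%g = 1 by rewrite -eM mulgV.
have cjM n v : cj ((e n - 1) * v) = (e (n ^ x^-1)%g - 1) * cj v.
  rewrite conjgE invgK !eM /cj !mulrBl !mul1r mulrBr mulrBl !mulrA.
  have xV1 : e x^-1%g * e x = 1 by rewrite -eM mulVg.
  by rewrite -[e x * e n * e x^-1%g * e x]mulrA xV1 mulr1.
have Ncj k v : aug N k v -> aug N k (cj v).
  elim=> {k v} [|k|k v w _ Nv _ Nw|k v _ Nv|i k n v Nn _ Nv|k l v le_lk _ Nv].
  - by rewrite /cj mulr1 cj1; apply: aug_one.
  - by rewrite /cj mulr0 mul0r; apply: aug_zero.
  - by rewrite /cj mulrDr mulrDl; apply: aug_add.
  - by rewrite /cj mulrN mulNr; apply: aug_opp.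
  - rewrite cjM; apply: aug_mul => //; rewrite conjg_mulR groupM //.
    by apply: subsetP (Nx i n Nn); apply: (p_seriesS serN).
  exact: aug_weak Nv.
have Nsub k v : aug N k v -> aug N k.+1 (cj v - v).
  elim=> {k v} [|k|k v w _ Nv _ Nw|k v _ Nv|i k n v Nn Naugv Nv|k l v le_lk _ Nv].
  - by rewrite /cj mulr1 cj1 subrr; apply: aug_zero.
  - by rewrite /cj mulr0 mul0r subrr; apply: aug_zero.
  - by rewrite /cj mulrDr mulrDl opprD addrACA; apply: aug_add.
  - by rewrite /cj mulrN mulNr -opprD; apply: aug_opp.
  - have -> : cj ((e n - 1) * v) - (e n - 1) * v
        = e n * ((e [~ n, x^-1]%g - 1) * cj v) + (e n - 1) * (cj v - v).
      rewrite cjM conjg_mulR eM mulrA [e n * (_ - 1)]mulrBr mulr1.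
      rewrite [(e n - 1) * (_ - _)]mulrBr addrA -mulrDl addrA subrK.
      by [].
    apply: aug_add; last by rewrite -addnS; apply: aug_mul.
    apply: aug_group; first by apply: subsetP Nn; apply: (p_seriesS serN).
    by rewrite -addSn; apply: aug_mul; [apply: Nx | apply: Ncj].
  exact: aug_weak Nv.
have -> : e (c * x)%g * u * e x^-1%g - u = (e c - 1) * cj u + (cj u - u).
  by rewrite mulrBl mul1r addrA subrK eM /cj !mulrA.
apply: aug_add; last exact: Nsub.
by apply: (aug_mul (i := 1%N)); last exact: Ncj.
Qed.

(* The operator [u |-> (c x) u x^-1 - u] raises weights by one, and in            *)
(* characteristic p its p-th power maps 1 to [(c x)^p x^-p - 1].                  *)
Lemma expMg_series N (c x : gT) : p_series p N -> (exists l, N l = 1%G) ->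
  \sum_(y in N 0%N) e y != 0 -> c \in N 1%N ->
  (forall i n, n \in N i -> [~ n, x^-1]%g \in N i.+1) ->
  ((c * x) ^+ p * x ^- p)%g \in N p.
Proof.
move=> serN trivN sum_neq0 Nc Nx; apply: aug_mem => //.
  elim: p => [|k IH]; first by rewrite !expg0 mul1g invg1 group1.
  have -> : ((c * x) ^+ k.+1 * x ^- k.+1)%g
            = (c * ((c * x) ^+ k * x ^- k) ^ x^-1)%g.
    by rewrite conjgE invgK !expgS invMg !mulgA.
  rewrite groupM //; first by rewrite (p_series01 serN).
  rewrite conjg_mulR groupM //; apply: subsetP (Nx _ _ IH).
  by apply: (p_seriesS serN).
have augn k : aug N k (iter k (fun v => e (c * x)%g * v * e x^-1%g - v) 1).
  by elim: k => [|k IH]; [apply: aug_one | apply: aug_twist].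
have := augn p; rewrite twist_pchar // mulr1 !expr_e -eM.
by rewrite expgVn.
Qed.

End AugmentationFiltration.

(** * The p-th power of [c x] for [c] in a subgroup of exponent p *)

(** Matrices of the regular representation model the group algebra, and [tau], a diagonal entry, is
    the coefficient of the identity. It shows that the sum of all group elements is nonzero, and
    later reads off the multiplication tensor. *)
Lemma regular_ring p (gT : finGroupType) : prime p ->
  exists (A : nzRingType) (e : gT -> A) (tau : {additive A -> 'F_p}),
  [/\ p \in [pchar A], e 1%g = 1, (forall x y, e (x * y)%g = e x * e y)
    & forall x, tau (e x) = (x == 1%g)%:R].
Proof.
move=> p_pr; pose rG := regular_repr 'F_p [set: gT]%G.
have: exists (r : gT -> 'M['F_p]_(gcard [set: gT])) i, [/\ r 1%g = 1%:M,
    forall x y, r (x * y)%g = r x *m r y & forall x, r x i i = (x == 1%g)%:R].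
  exists rG, (gring_index [set: gT] 1%g); split=> [|x y|x].
  - exact: repr_mx1.
  - by rewrite repr_mxM ?inE.
  rewrite !mxE gring_indexK ?inE // mul1g eqxx /=.
  by rewrite -(inj_eq (can_inj gring_valK)) !gring_indexK ?inE // eq_sym.
(* Square matrices form a nonzero ring only in positive size; the index [i] excludes size 0. *)
case: (gcard _) => [|n] [r [i [r1 rM rE]]]; first by have := ltn_ord i.
pose tau (M : 'M['F_p]_n.+1) := M i i.
have tauB : zmod_morphism tau by move=> M1 M2; rewrite /tau !mxE.
pose taum := GRing.isZmodMorphism.Build _ _ tau tauB.
pose tauA : {additive 'M['F_p]_n.+1 -> 'F_p} := HB.pack tau taum.
exists 'M['F_p]_n.+1, r, tauA; split=> //.
rewrite inE p_pr /=; apply/eqP/matrixP=> k l.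
by rewrite -scaler_nat (pcharf0 (pchar_Fp p_pr)) scale0r.
Qed.

Lemma three_subgroup_norm (gT : finGroupType) (G H K N : {group gT}) :
  G \subset 'N(N)%g -> H \subset 'N(N)%g -> K \subset 'N(N)%g ->
  [~: G, H, K]%g \subset N -> [~: H, K, G]%g \subset N -> [~: K, G, H]%g \subset N.
Proof.
move=> nG nH nK.
have comm3 (X Y Z : {group gT}) : X \subset 'N(N)%g -> Y \subset 'N(N)%g ->
    Z \subset 'N(N)%g ->
    ([~: X, Y, Z]%g \subset N) = ([~: X / N, Y / N, Z / N]%g == 1%g).
  move=> nX nY nZ; have nXY : [~: X, Y]%g \subset 'N(N)%g.
    by apply: subset_trans (commgSS nX nY) (der_sub 1 'N(N)%G).
  rewrite -!quotientR // -quotient_sub1 ?subG1 //.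
  by apply: subset_trans (commgSS nXY nZ) (der_sub 1 'N(N)%G).
rewrite !comm3 // => /eqP GHK /eqP HKG; apply/eqP.
exact: three_subgroup GHK HKG.
Qed.

Section LowerSeries.

Variables (gT : finGroupType) (K H : {group gT}).
Hypotheses (sKH : K \subset H) (nKH : H \subset 'N(K)%g).

(* Indexed from 1; the entry of index 0 is a copy of K, as p_series requires. *)
Fixpoint lower_series (n : nat) : {group gT} :=
  if n is (n'.+1 as m).+1 then [~: lower_series m, H]%G else K.

Lemma lower_seriesSS n : lower_series n.+2 = [~: lower_series n.+1, H]%G.
Proof. by []. Qed.

Lemma lower_series_norm n : H \subset 'N(lower_series n)%g.
Proof.
by elim: n => [|[|n] IH] //; rewrite lower_seriesSS normsR // normG.
Qed.

Lemma lower_series_subS n : lower_series n.+1 \subset lower_series n.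
Proof. by case: n => [|n] //; rewrite commg_subl; apply: (lower_series_norm n.+1). Qed.

Lemma lower_seriesS i j : (i <= j)%N -> lower_series j \subset lower_series i.
Proof.
elim: j => [|j IH]; first by rewrite leqn0 => /eqP->.
rewrite leq_eqVlt => /predU1P[-> // | /IH]; apply: subset_trans.
exact: lower_series_subS.
Qed.

Lemma lower_series_sub n : lower_series n \subset H.
Proof. exact: subset_trans (lower_seriesS (leq0n n)) sKH. Qed.

Lemma lower_series_commH i : [~: lower_series i, H]%g \subset lower_series i.+1.
Proof. by case: i => [|i] //; rewrite commg_subl. Qed.

Lemma lower_series_comm i j :
  [~: lower_series i, lower_series j]%g \subset lower_series (i + j).
Proof.
have norm0 n : [~: lower_series n, lower_series 0%N]%g \subset lower_series n.
  by rewrite commg_subl (subset_trans (lower_series_sub _)) ?lower_series_norm.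
elim: j i => [|[|j] IH] i; first by rewrite addn0.
  rewrite addn1; apply: subset_trans _ (lower_series_commH i).
  by rewrite commgS ?lower_series_sub.
rewrite lower_seriesSS commGC.
have nL n : lower_series n \subset 'N(lower_series (i + j.+2))%g.
  by rewrite (subset_trans (lower_series_sub _)) ?lower_series_norm.
apply: (three_subgroup_norm (G := H)) => //; first exact: lower_series_norm.
  rewrite addnS -addSn; apply: subset_trans _ (IH i.+1); apply: commSg.
  by rewrite commGC lower_series_commH.
rewrite addnS; apply: subset_trans _ (lower_series_commH (i + j.+1)).
by apply: commSg; apply: IH.
Qed.

End LowerSeries.

(** The lower series of [K] is a p-series because [K] has exponent p, so [expMg_series] puts
    [(c x)^p x^-p] in its p-th term, which is trivial. *)
Lemma expMg_lower_series p (gT : finGroupType) (H K : {group gT}) (c x : gT) :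
  prime p -> K \subset H -> H \subset 'N(K)%g -> c \in K -> x \in H ->
  lower_series K H p = 1%G -> (forall y, y \in K -> y ^+ p = 1)%g ->
  ((c * x) ^+ p = x ^+ p)%g.
Proof.
move=> p_pr sKH nKH Kc Hx Lp Kp.
have [A [e [tau [pA e1 eM tauE]]]] := regular_ring gT p_pr.
have serL : p_series p (lower_series K H).
  split=> // [i j|i j|i g Lg].
  - exact: lower_seriesS.
  - exact: lower_series_comm.
  by rewrite Kp ?group1 //; apply: (subsetP (lower_seriesS nKH (leq0n i))).
have: ((c * x) ^+ p * x ^- p)%g \in lower_series K H p.
  apply: (expMg_series pA e1 eM serL) => //.
  - by exists p.
  - apply: contraTneq (oner_neq0 'F_p) => sum0.
    rewrite negbK -(raddf0 tau) -sum0 raddf_sum (bigD1 1%g) //=.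
    rewrite big1 ?addr0 => [|y /andP[_ /negPf ny]]; last by rewrite tauE ny.
    by rewrite tauE eqxx.
  move=> i n Ln; apply: subsetP (lower_series_commH nKH i) _ _.
  by rewrite mem_commg ?groupV.
by rewrite Lp => /set1gP/eqP; rewrite -eq_mulgV1 => /eqP.
Qed.

(** * Commutators in the p-lower central series *)

Section PlcsSeries.

Variables (p : nat) (gT : finGroupType) (G : {group gT}).
Hypothesis p_pr : prime p.

Let p_gt1 : (1 < p)%N := prime_gt1 p_pr.
Notation Gam := (plcs p G).
Notation GamG := (plcs_group p G).

Lemma plcs0 : plcs_group p G 0 = G.
Proof. exact/val_inj. Qed.

Lemma ceil_divn_mulr m d : (0 < d)%N -> ceil_divn (d * m) d = m.
Proof. by move=> d_gt0; rewrite /ceil_divn dvdn_mulr // addn0 mulKn. Qed.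

Lemma plcs_expg i g : g \in plcs p G i -> (g ^+ p)%g \in plcs p G (p * i).
Proof.
case: i => [|i] Gg; first by rewrite muln0; apply: (groupX p (G := G)).
rewrite plcsE //; last by nia.
rewrite ceil_divn_mulr ?prime_gt0 //.
apply: (subsetP (mulG_subr [~: G, GamG _]%G _)).
exact/mem_gen/imset_f.
Qed.

Lemma plcs_subnorm i j : Gam i \subset 'N(Gam j)%g.
Proof.
apply: subset_trans (normal_sub (plcs_normal p G i)) _.
exact: normal_norm (plcs_normal p G j).
Qed.

(* Modulo Gamma_(pk+j), the conjugate x^y is c x with c = [y, x^-1], and          *)
(* Gamma_(k+j) has exponent p; so x^y and x have the same p-th power.             *)
Lemma plcs_expg_comm k j x y : (0 < k)%N ->
  (forall m, [~: Gam k, Gam m]%g \subset Gam (k + m)) ->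
  x \in Gam k -> y \in Gam j -> [~ x ^+ p, y]%g \in Gam (p * k + j).
Proof.
move=> k_gt0 IHk Gx Gy.
pose N := GamG (p * k + j).
have nGN : G \subset 'N(N)%g by apply: normal_norm (plcs_normal p G _).
have sGam i : Gam i \subset G by apply: normal_sub (plcs_normal p G i).
have nN i : Gam i \subset 'N(N)%g by apply: plcs_subnorm.
have [nx ny] := (subsetP (nN _) _ Gx, subsetP (nN _) _ Gy).
pose Q i := (GamG i / N)%G.
pose c := [~ y, x^-1]%g.
have Gc : c \in Gam (k + j).
  by apply: (subsetP (IHk j)); rewrite commGC mem_commg ?(groupV (GamG k)).
have nc := subsetP (nN _) _ Gc.
have sQ i l : (i <= l)%N -> Q l \subset Q i.
  by move=> le_il; apply/quotientS/plcsS.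
have QR m : [~: Q m, Q k]%g \subset Q (k + m)%N.
  rewrite commGC /= -quotientR //; apply: quotientS; exact: IHk.
(* At [i = p.-1] the bound is [Q (p * k + j)], which is trivial. *)
have lowQ i : lower_series (Q (k + j)%N) (Q k) i.+1 \subset Q (i.+1 * k + j)%N.
  elim: i => [|i IH]; first by rewrite mul1n.
  rewrite lower_seriesSS (mulSn i.+1) -addnA.
  by apply: subset_trans (commSg _ IH) (QR _).
have: ((coset N c * coset N x) ^+ p = coset N x ^+ p)%g.
  apply: (@expMg_lower_series p _ (Q k) (Q (k + j)%N)) => //.
  - by apply: sQ; apply: leq_addr.
  - by rewrite quotient_norms // plcs_subnorm.
  - exact: mem_quotient.
  - exact: mem_quotient.
  - apply/val_inj/trivgP; have := lowQ p.-1; rewrite prednK ?prime_gt0 //.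
    by rewrite /Q /= trivg_quotient.
  move=> _ /morphimP[z nz Gz ->]; rewrite -morphX //; apply: coset_id.
  by apply: (subsetP (plcsS _ p_gt1 _)) (plcs_expg Gz); rewrite mulnDr; nia.
have -> : (coset N c * coset N x)%g = coset N (x ^ y)%g.
  rewrite -morphM //; congr (coset N _).
  by rewrite /c commgEl conjgE invgK conjgE !mulgA mulgKV.
rewrite -!morphX ?groupJ // => eq_c.
have : coset N [~ x ^+ p, y]%g = 1%g.
  by rewrite commgEl conjXg morphM ?groupV ?groupX ?groupJ // morphV ?groupX //= eq_c mulVg.
by apply: coset_idr; rewrite groupR ?groupX.
Qed.

(** For [i >= 2], the factor [[G, Gamma_(i-1)]] of Gamma_i is handled by the three subgroups lemma,
    and the p-th powers from Gamma_k, with [k < i] the ceiling of [i / p], by [plcs_expg_comm]. *)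
Lemma plcs_comm i j : [~: Gam i, Gam j]%g \subset Gam (i + j).
Proof.
elim/ltn_ind: i j => -[|[|i]] IH j.
- rewrite add0n commg_subr; exact: normal_norm (plcs_normal p G j).
- case: j => [|j]; last by rewrite add1n; apply: commg_plcs.
  exact: der_sub 1 G.
pose N := GamG (i.+2 + j).
have nN l : Gam l \subset 'N(N)%g by apply: plcs_subnorm.
rewrite -quotient_cents2 // plcsE //.
have sGamG l : Gam l \subset G by apply: normal_sub (plcs_normal p G l).
have sR : [~: G, Gam i.+1]%g \subset Gam i.+2 by apply: commg_plcs.
pose k := ceil_divn i.+2 p.
have k_gt0 : (0 < k)%N by rewrite ltnNge ceil_divn_leq ?prime_gt0.
have lt_k : (k < i.+2)%N by apply: ceil_divn_lt.
have le_pk : (i.+2 <= p * k)%N by rewrite mulnC -ceil_divn_leq ?prime_gt0.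
have sP : pow_subgroup p (Gam k) \subset Gam i.+2.
  by rewrite (plcsE G p_gt1 (i := i.+2)) //; apply: (mulG_subr [~: G, GamG _]%G).
rewrite quotientMl ?(subset_trans sR) // mul_subG //.
  rewrite quotient_cents2 ?(subset_trans sR) //.
  have nGN : G \subset 'N(N)%g by apply: normal_norm (plcs_normal p G _).
  apply: (three_subgroup_norm (G := GamG i.+1) (H := GamG j) (K := G)); first exact: nN.
  - exact: nN.
  - exact: nGN.
  - apply: subset_trans (commSg G (IH i.+1 (ltnSn _) j)) _.
    by rewrite commGC; apply: commg_plcs.
  have sjG : [~: Gam j, G]%g \subset Gam j.+1.
    case: (j) => [|l]; first exact: der_sub 1 G.
    by rewrite commGC; apply: commg_plcs.
  apply: subset_trans (commSg _ sjG) _.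
  by rewrite commGC /N /= addSnnS; apply: IH.
rewrite quotient_gen ?gen_subG; last first.
  by apply: subset_trans (nN i.+2); apply: subset_trans sP; apply: subset_gen.
apply/subsetP=> _ /morphimP[z nz /imsetP[x Gx def_z] ->]; rewrite {z}def_z in nz *.
apply/centP=> _ /morphimP[y ny Gy ->]; apply/commgP; rewrite -morphR //=.
rewrite coset_id //; apply: (subsetP (plcsS G p_gt1 (leq_add le_pk (leqnn j)))).
by apply: plcs_expg_comm => // m; apply: IH.
Qed.

Lemma plcs_p_series : p_series p (plcs_group p G).
Proof.
split=> [|i j|i j|i g].
- exact: val_inj.
- exact: plcsS.
- exact: plcs_comm.
exact: plcs_expg.
Qed.

End PlcsSeries.

(** * Hoeffding's inequality for the number of exponent families *)

Section Hoeffding.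

Variable R : realType.
Implicit Types (x y s t : R) (m : nat).

Lemma ge0_derive_le (f df : R -> R) y : 0 <= y ->
  (forall x, is_derive x 1 f (df x)) -> (forall x, 0 <= x -> 0 <= df x) ->
  f 0 <= f y.
Proof.
rewrite le_eqVlt => /predU1P[<- // | y_gt0] fE df_ge0.
have [|z] := MVT y_gt0 (fun x _ => fE x).
  by apply: derivable_within_continuous => x _; apply: ex_derive.
rewrite in_itv /= => /andP[z_gt0 _] fB.
by rewrite -subr_ge0 fB mulr_ge0 ?df_ge0 ?subr_ge0 // ltW.
Qed.

(** For [x >= 0] the quotient of [cosh x] by [exp(x^2/2)] decreases, because
    [x cosh x - sinh x >= 0]; this in turn vanishes at 0 and has derivative [x sinh x >= 0]. *)
Lemma cosh_le_expR_sqr y : expR y + expR (- y) <= 2 * expR (y ^+ 2 / 2).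
Proof.
wlog y_ge0 : y / 0 <= y.
  move=> wlog_y; have [/wlog_y // | /ltW y_le0] := leP 0 y.
  by rewrite addrC -{2}[y]opprK -[y ^+ 2]sqrrN; apply: wlog_y; rewrite oppr_ge0.
have expNE x : is_derive x 1 (fun x => expR (- x)) (- expR (- x)).
  have dN : is_derive x 1 (-%R : R -> R) (-1) by apply: is_deriveNid.
  by have := is_derive1_comp (is_derive_expR (- x)) dN; rewrite mulrN1.
have sinh_ge0 x : 0 <= x -> 0 <= expR x - expR (- x).
  by move=> x_ge0; rewrite subr_ge0 ler_expR; lra.
pose k x := x * (expR x + expR (- x)) - (expR x - expR (- x)).
have k_ge0 x : 0 <= x -> 0 <= k x.
  move=> x_ge0; have -> : 0 = k 0 by rewrite /k oppr0; ring.
  apply: (ge0_derive_le (df := fun x => x * (expR x - expR (- x)))) => // z.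
    apply: is_derive_eq; rewrite /GRing.scale /=; ring.
  by move=> z_ge0; rewrite mulr_ge0 ?sinh_ge0.
pose h x := - ((expR x + expR (- x)) * expR (- (x ^+ 2 / 2))).
have : h 0 <= h y.
  apply: (ge0_derive_le (df := fun x => k x * expR (- (x ^+ 2 / 2)))) => // z.
    have gE : is_derive z 1 (fun x => expR (- (x ^+ 2 / 2))) (- z * expR (- (z ^+ 2 / 2))).
      have dQ : is_derive z 1 (fun x => - (x ^+ 2 / 2) : R) (- z).
        by apply: is_derive_eq; rewrite /GRing.scale /=; field.
      rewrite mulrC; exact: (@is_derive1_comp _ expR (fun x => - (x ^+ 2 / 2))).
    apply: is_derive_eq; rewrite /GRing.scale /k /=; ring.
  by move=> z_ge0; rewrite mulr_ge0 ?k_ge0 ?expR_ge0.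
rewrite /h lerN2 oppr0 expr0n /= mul0r oppr0 expR0 mulr1.
by rewrite [expR (- (_ / _))]expRN ler_pdivrMr ?expR_gt0 // -[1 + 1]/2.
Qed.

(** Pairing [a] with [p - 1 - a] gives, up to the factor for the mean, values of [2 cosh]. *)
Lemma hoeffding_uniform s p : (0 < p)%N ->
  \sum_(a < p) expR (- (s * a%:R))
  <= p%:R * expR (- (s * p.-1%:R / 2) + (s * p.-1%:R) ^+ 2 / 8).
Proof.
move=> p_gt0; rewrite -(ler_pM2l (ltr0Sn R 1)).
have -> : 2 * \sum_(a < p) expR (- (s * a%:R))
    = \sum_(a < p) (expR (- (s * a%:R)) + expR (- (s * (p.-1 - a)%N%:R))).
  rewrite big_split /= mulr_natl mulr2n; congr (_ + _).
  rewrite (reindex_inj rev_ord_inj); apply: eq_bigr => a _ /=.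
  by congr (expR (- (_ * _%:R))); have := ltn_ord a; lia.
set E := expR (_ + _); rewrite mulrCA -[X in _ <= X%:R * _](card_ord p).
rewrite mulr_natl -sumr_const; apply: ler_sum => a _.
set b := (p.-1 - a)%N; pose y : R := s * (b%:R - a%:R) / 2.
have ab : p.-1%:R = a%:R + b%:R :> R.
  by rewrite -natrD; congr (_%:R); rewrite /b; have := ltn_ord a; lia.
have -> : expR (- (s * a%:R)) + expR (- (s * b%:R))
          = expR (- (s * p.-1%:R / 2)) * (expR y + expR (- y)).
  by rewrite mulrDr -!expRD ab /y; congr (expR _ + expR _); field.
apply: le_trans (ler_wpM2l (expR_ge0 _) (cosh_le_expR_sqr y)) _.
rewrite mulrCA -expRD ler_pM2l // /E ler_expR lerD2l ab /y -subr_ge0.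
have -> : (s * (a%:R + b%:R)) ^+ 2 / 8 - (s * (b%:R - a%:R) / 2) ^+ 2 / 2
          = s ^+ 2 * (a%:R * b%:R) / 2 by field.
by rewrite divr_ge0 // mulr_ge0 ?sqr_ge0 // mulr_ge0.
Qed.

(** Chernoff's method: a counted family has weight at most [m - 1], so [exp(t (m - 1 - weight))] is
    at least 1; its sum over all families factors. *)
Lemma num_below_le p ws t m : 0 <= t ->
  (num_below p ws m)%:R
  <= expR (t * (m%:R - 1)) * \prod_(w <- ws) \sum_(a < p) expR (- (t * w%:R * a%:R)).
Proof.
move=> t_ge0; have prod_ge0 vs : 0 <= \prod_(w <- vs) \sum_(a < p) expR (- (t * w%:R * a%:R)).
  by apply: prodr_ge0 => w _; apply: sumr_ge0 => a _; apply: expR_ge0.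
elim: ws m => [|w ws IH] m /=.
  rewrite big_nil mulr1; case: m => [|m]; first exact: expR_ge0.
  by rewrite -[1%:R]expR0 ler_expR mulr_ge0 // -natr1 addrK ler0n.
rewrite big_cons mulrCA mulrA mulr_suml natr_sum mulr_suml; apply: ler_sum => a _.
have [le_m | lt_m] := leqP m (w * a).
  have -> : (m - w * a)%N = 0%N by lia.
  have num0 vs : num_below p vs 0 = 0%N.
    by elim: vs => //= v vs IHv; apply: big1 => b _; rewrite sub0n.
  by rewrite num0 !mulr_ge0 ?expR_ge0 ?prod_ge0.
apply: le_trans (IH _) _; rewrite ler_wpM2r ?prod_ge0 // -expRD ler_expR.
by rewrite natrB 1?ltnW // natrM; nra.
Qed.

(** By [3 (m - 1) <= (p - 1) s] the exponent is at most [- t (p - 1) s / 6 + t^2 (p - 1)^2 q / 8],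
    whose minimum over [t] is [- s^2 / (18 q)]. *)
Lemma num_below_chernoff p ws m : prime p ->
  (0 < \sum_(w <- ws) w)%N -> (3 * (m.-1) <= p.-1 * \sum_(w <- ws) w)%N -> (0 < m)%N ->
  (num_below p ws m)%:R <= p%:R ^+ size ws
     * expR (- ((\sum_(w <- ws) w)%N%:R ^+ 2 / (\sum_(w <- ws) w ^ 2)%N%:R / 18)) :> R.
Proof.
move=> p_pr s_gt0 le_m m_gt0; have p_gt1 := prime_gt1 p_pr.
set s := (\sum_(w <- ws) w)%N in s_gt0 le_m *; set q := (\sum_(w <- ws) w ^ 2)%N.
have q_gt0 : (0 < q)%N.
  apply: leq_trans s_gt0 _; apply: leq_sum => w _.
  by case: w => // w; rewrite expnS leq_pmulr // expn_gt0.
have sR : 0 < s%:R :> R by rewrite ltr0n.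
have qR : 0 < q%:R :> R by rewrite ltr0n.
have cR : 0 < p.-1%:R :> R by rewrite ltr0n; lia.
(* The minimum of [- t (p-1) s / 6 + t^2 (p-1)^2 q / 8]. *)
pose t : R := 2 * s%:R / (3 * p.-1%:R * q%:R).
have t_ge0 : 0 <= t by rewrite divr_ge0 ?mulr_ge0 // ltW.
apply: le_trans (num_below_le p ws m t_ge0) _.
have prod_le vs : \prod_(w <- vs) \sum_(a < p) expR (- (t * w%:R * a%:R))
    <= p%:R ^+ size vs * expR (- (t * p.-1%:R * (\sum_(w <- vs) w)%N%:R / 2)
         + t ^+ 2 * p.-1%:R ^+ 2 * (\sum_(w <- vs) w ^ 2)%N%:R / 8).
  elim: vs => [|w vs IH].
    by rewrite !big_nil /= expr0 mul1r !(mulr0, mul0r) oppr0 addr0 expR0.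
  rewrite !big_cons /= exprS.
  apply: le_trans (ler_pM _ _ (hoeffding_uniform (t * w%:R) (ltnW p_gt1)) IH) _.
  - by apply: sumr_ge0 => a _; apply: expR_ge0.
  - by apply: prodr_ge0 => v _; apply: sumr_ge0 => a _; apply: expR_ge0.
  rewrite mulrACA -expRD ler_wpM2l ?mulr_ge0 ?exprn_ge0 // ler_expR.
  by rewrite !natrD natrX le_eqVlt; apply/orP; left; apply/eqP; field.
apply: le_trans (ler_wpM2l (expR_ge0 _) (prod_le ws)) _.
rewrite mulrCA -expRD -/s -/q ler_wpM2l ?exprn_ge0 // ler_expR.
have le_mR : 3 * (m%:R - 1) <= p.-1%:R * s%:R :> R.
  by rewrite -(@natrB _ m 1) // subn1 -!natrM ler_nat.
have -> : - (s%:R ^+ 2 / q%:R / 18)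
   = t * (p.-1%:R * s%:R / 3) + (- (t * p.-1%:R * s%:R / 2) + t ^+ 2 * p.-1%:R ^+ 2 * q%:R / 8).
  by rewrite /t; field; rewrite ?lt0r_neq0.
rewrite lerD2r ler_wpM2l //; lra.
Qed.

End Hoeffding.

(** * Slice rank of the multiplication tensor *)

Lemma slice_rank_le (X Y Z : finType) (F : fieldType) (T : X -> Y -> Z -> F) r :
  slice_decomp T r -> (slice_rank T <= r)%N.
Proof.
move=> decT; rewrite /slice_rank; case: ex_minnP => k _; apply.
exact/asboolP.
Qed.

(** With [x'], [y'], [z'] the remainders modulo the span, each of the first three terms has a factor
    in the span, and the last one vanishes. *)
Lemma mulr3_split (A : pzRingType) (x y z x' y' z' : A) :
  x * y * z = x * y * (z - z') + x * (y - y') * z' + (x - x') * (y' * z') + x' * y' * z'.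
Proof.
rewrite !mulrBr !mulrBl !mulrA; set t := x * y * z'; set t' := x * y' * z'.
by rewrite !addrA !subrK.
Qed.

(* If the products of three elements of an ideal I vanish, then replacing each  *)
(* group element by its representative modulo I, in the span of d elements,     *)
(* writes the tensor as a sum of three tensors of slice rank at most d.           *)
Lemma slice_rank_num_below p (gT : finGroupType) (N : nat -> {group gT}) ws m :
  prime p -> p_series p N -> N 0%N = [set: gT]%G -> peel_chain p N ws ->
  (p.-1 * \sum_(w <- ws) w.1 < 3 * m)%N ->
  (slice_rank (mul_tensor 'F_p gT) <= 3 * num_below p (unzip1 ws) m)%N.
Proof.
move=> p_pr serN N0 chN lt_m.
have [A [e [tau [pA e1 eM tauE]]]] := regular_ring gT p_pr.
have [c [sz_c span_c]] := peel_chain_spans pA e1 eM m chN serN.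
set d := num_below _ _ _ in sz_c *.
have /choice[phi phiP] x : exists f : nat -> nat,
    aug e N m (e x - \sum_(i < size c) c`_i *+ f i).
  apply: span_c; rewrite -[e x]mulr1.
  by apply: (aug_group (N := N)); [rewrite N0 inE | apply: aug_one].
pose rho x := \sum_(i < d) c`_i *+ phi x i.
pose u x := e x - rho x.
have uuu x y z : u x * u y * u z = 0.
  have aug_u v : aug e N m (u v) by rewrite /u /rho -sz_c; apply: phiP.
  have := aug_prod (aug_prod (aug_u x) (aug_u y)) (aug_u z).
  by move/(peel_chain_aug_eq0 pA e1 eM chN serN); apply; lia.
have tau_rho a b x :
    tau (a * rho x * b) = \sum_(i < d) tau (a * c`_i * b) * (phi x i)%:R.
  rewrite /rho mulr_sumr mulr_suml raddf_sum; apply: eq_bigr => i _.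
  by rewrite mulr_natr -raddfMn; congr (tau _); rewrite mulrnAr mulrnAl.
apply: slice_rank_le; exists d, (d + d)%N.
have -> : (3 * d = d + (d + d))%N by lia.
rewrite leq_addr leq_addl; split=> //.
exists (fun i x y => tau (e x * e y * c`_i * 1)), (fun i z => (phi z^-1%g i)%:R).
exists (fun i x z => tau (e x * c`_(i - d) * u z^-1%g)), (fun i y => (phi y (i - d)%N)%:R).
exists (fun i y z => tau (1 * c`_(i - (d + d)) * (u y * u z^-1%g))),
  (fun i x => (phi x (i - (d + d))%N)%:R).
move=> x y z; rewrite big_mkord -tau_rho.
have shift k (f : nat -> 'F_p) :
    \sum_(k <= i < d + k) f (i - k)%N = \sum_(i < d) f i.
  rewrite -{1}[k]add0n big_addn addnK big_mkord.
  by apply: eq_bigr => i _; rewrite addnK.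
rewrite (shift d (fun i => tau (e x * c`_i * u z^-1%g) * (phi y i)%:R)) -tau_rho.
rewrite (shift (d + d)%N (fun i => tau (1 * c`_i * (u y * u z^-1%g)) * (phi x i)%:R)).
rewrite -tau_rho mul1r mulr1 -!raddfD /=.
have -> : mul_tensor 'F_p gT x y z = tau (e x * e y * e z^-1%g).
  by rewrite -!eM tauE /mul_tensor eq_mulgV1.
congr (tau _); set v := z^-1%g.
have rhoE w : rho w = e w - u w by rewrite /u subKr.
by rewrite !rhoE (mulr3_split _ _ _ (u x) (u y) (u v)) uuu addr0.
Qed.

(** * The p-degrees as multiplicities of weights, and the final bound *)

Lemma sum_count_mem (f : nat -> nat) l (W : seq nat) :
  all (fun w => (1 <= w <= l)%N) W ->
  (\sum_(1 <= j < l.+1) f j * count_mem j W = \sum_(w <- W) f w)%N.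
Proof.
elim: W => [|w W IH] /=.
  by move=> _; rewrite big_nil big1 // => j _; rewrite muln0.
case/andP=> w_in /IH def_W; rewrite big_cons -def_W.
rewrite (eq_bigr (fun j => f j * (w == j) + f j * count_mem j W))%N; last first.
  by move=> j _; rewrite mulnDr.
rewrite big_split /=; congr (_ + _)%N.
rewrite (bigD1_seq w) ?iota_uniq ?mem_index_iota //= eqxx muln1.
by rewrite big1 ?addn0 // => j /negPf; rewrite eq_sym => ->; rewrite muln0.
Qed.

(** The order of Gamma_j is p to the number of weights at least [j], so its quotient by Gamma_(j+1)
    counts the weights equal to [j]. *)
Lemma p_degree_chain p (gT : finGroupType) (G : {group gT}) ws j : prime p ->
  peel_chain p (plcs_group p G) ws -> p_degree p G j = count_mem j (unzip1 ws).
Proof.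
move=> p_pr chN; have serN := plcs_p_series G p_pr.
rewrite /p_degree card_quotient; last exact: plcs_subnorm.
have sN : plcs p G j.+1 \subset plcs p G j by apply: plcsS; rewrite ?prime_gt1.
have -> : #|plcs p G j : plcs p G j.+1|%g = (p ^ count_mem j (unzip1 ws))%N.
  have cardN i := peel_chain_card i chN serN.
  apply/eqP; rewrite -(eqn_pmul2l (cardG_gt0 (plcs_group p G j.+1))).
  rewrite (Lagrange (G := plcs_group p G j) (H := plcs_group p G j.+1)) //.
  rewrite !cardN -expnD; apply/eqP; congr (_ ^ _)%N.
  elim: (ws) => //= w s IH.
  by rewrite IH; case: ltngtP; lia.
by rewrite pfactorK.
Qed.

Lemma slice_rank_mul_tensor (R : realType) (p n : nat) (G : finGroupType) :
  prime p -> (1 <= n)%N -> #|G| = (p ^ n)%N ->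
  (slice_rank (mul_tensor 'F_p G))%:R
    <= 3 * #|G|%:R * expR (- (delta R p [set: G] / 18)) :> R.
Proof.
move=> p_pr n_gt0 cardG; have p_gt1 := prime_gt1 p_pr.
have pG : (p.-group [set: G])%g by rewrite /pgroup cardsT cardG pnatX pnat_id.
pose N := plcs_group p [set: G]%G.
have serN : p_series p N := plcs_p_series _ p_pr.
have [N1 _] := plcs_lengthP p_pr pG.
set l := plcs_length p [set: G] in N1.
have trivN : exists l, N l = 1%G by exists l.+1; apply: val_inj.
have [[ws chN] _] := exists_peel_chain p_pr serN trivN.
have cardN i := peel_chain_card i chN serN.
set W := unzip1 ws.
have countW (P : pred nat) : count (fun w => P w.1) ws = count P W by rewrite count_map.
have sizeW : size W = n.
  apply/eqP; rewrite -(eqn_exp2l _ _ p_gt1) -cardG -cardsT -[[set: G]]/(val (N 0%N)).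
  by rewrite cardN (countW (leq 0)) count_predT.
(* Since [N 1] is the whole group and [N l.+1] is trivial, comparing orders puts every weight
   between 1 and [l]. *)
have W_in : all (fun w => (1 <= w <= l)%N) W.
  have W_ge1 : all (leq 1) W.
    rewrite all_count -(eqn_exp2l _ _ p_gt1) sizeW -cardG -cardsT.
    by rewrite -(countW (leq 1)) -cardN.
  have W_le : ~~ has (leq l.+1) W.
    rewrite has_count -(countW (leq l.+1)) -leqNgt -(leq_exp2l _ _ p_gt1) -cardN.
    by rewrite /= N1 cards1.
  apply/allP=> w Ww; rewrite (allP W_ge1) //=.
  by rewrite leqNgt; apply: contra W_le => lt_lw; apply/hasP; exists w.
have deltaE : delta R p [set: G]
    = (\sum_(w <- W) w)%N%:R ^+ 2 / (\sum_(w <- W) w ^ 2)%N%:R.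
  rewrite /delta -/l; congr (_%:R ^+ 2 / _%:R).
    rewrite -(sum_count_mem id W_in); apply: eq_bigr => j _.
    by rewrite (p_degree_chain _ p_pr chN).
  rewrite -(sum_count_mem (fun w => w ^ 2)%N W_in); apply: eq_bigr => j _.
  by rewrite (p_degree_chain _ p_pr chN).
set s := (\sum_(w <- W) w)%N in deltaE.
have s_gt0 : (0 < s)%N.
  apply: leq_trans n_gt0 _; rewrite -sizeW -sum1_size /s big_seq [X in (_ <= X)%N]big_seq.
  by apply: leq_sum => w /(allP W_in)/andP[].
(* The least [m] with [3 m > (p - 1) s]; it also satisfies the hypothesis [3 (m - 1) <= (p - 1) s]
   of [num_below_chernoff]. *)
pose m := ((p.-1 * s) %/ 3).+1.
have lt_m : (p.-1 * \sum_(w <- ws) w.1 < 3 * m)%N.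
  by rewrite -(big_map fst predT id) -/W -/s [(3 * m)%N]mulnC ltn_ceil.
have le_sr := slice_rank_num_below p_pr serN (plcs0 p _) chN lt_m.
apply: le_trans (_ : (3 * num_below p W m)%N%:R <= _); first by rewrite ler_nat le_sr.
rewrite natrM -mulrA ler_pM2l // deltaE cardG natrX -sizeW.
by apply: num_below_chernoff => //; rewrite mulnC leq_trunc_div.
Qed.

Theorem theorem3p11 (R : realType) :
  (forall (p n : nat) (G : finGroupType),
     prime p -> (1 <= n)%N -> #|G| = (p ^ n)%N ->
     ((slice_rank (mul_tensor 'F_p G))%:R
        <= 3 * #|G|%:R * expR (- (delta R p [set: G] / 18)) :> R)%R)
  /\
  (exists C c : R, (0 < C)%R /\ (0 < c)%R /\
     forall (p n : nat) (G : finGroupType),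
       prime p -> (1 <= n)%N -> #|G| = (p ^ n)%N ->
       ((slice_rank (mul_tensor 'F_p G))%:R
          <= C * p%:R ^+ n / expR (c * delta R p [set: G]) :> R)%R).
Proof.
split; first exact: slice_rank_mul_tensor.
exists 3, (18^-1); split; [by [] | split; first by rewrite invr_gt0].
move=> p n G p_pr n_gt0 cardG.
apply: le_trans (slice_rank_mul_tensor R p_pr n_gt0 cardG) _.
by rewrite cardG natrX expRN [_^-1 * _]mulrC.
Qed.
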